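(* Let $F$ be a field and let $A$ be a finite dimensional splitting $F$-algebra. If $A$ has finite global dimension, then $A$ is zero product determined. In particular, all quasi-hereditary cellular algebras over a field are zero product determined.
   Context: All algebras are unital and associative, all modules are unital left modules. An $F$-algebra $A$ is zero product determined if for every $F$-bilinear map $f: A\times A\to F$ with the property that $f(a,b)=0$ whenever $ab=0$, there exists a linear map $\Phi: A\to F$ such that $f(x,y)=\Phi(xy)$ for all $x,y\in A$. A finite dimensional irreducible $A$-module $V$ is absolutely irreducible if $K\otimes_F V$ is an irreducible $(K\otimes_F A)$-module for every field extension $F\subseteq K$, equivalently $\operatorname{End}_A(V)\cong F$. A finite dimensional $F$-algebra $A$ is splitting if all irreducible $A$-modules are absolutely irreducible. The global dimension of $A$ is the supremum of the projective dimensions of $A$-modules. A finite dimensional $F$-algebra $A$ is cellular (in the sense of Graham and Lehrer) if there are a finite poset $\Lambda$, a finite set $M(\lambda)$ for each $\lambda\in\Lambda$, an $F$-basis $\{C^\lambda_{s,t} : \lambda\in\Lambda,\ s,t\in M(\lambda)\}$ of $A$, and an $F$-linear anti-involution $*$ of $A$ such that $(C^\lambda_{s,t})^*=C^\lambda_{t,s}$ for all $\lambda, s,t$, and such that for all $a\in A$, $\lambda\in\Lambda$, $s,t\in M(\lambda)$ one has $aC^\lambda_{s,t}\equiv\sum_{s'\in M(\lambda)} r_a(s',s)\,C^\lambda_{s',t} \pmod{A(<\lambda)}$, where $r_a(s',s)\in F$ is independent of $t$ and $A(<\lambda)$ is the span of all $C^\mu_{u,v}$ with $\mu<\lambda$ and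 $u,v\in M(\mu)$. A finite dimensional algebra $A$ is quasi-hereditary if there is a chain of two-sided ideals $0=J_0\subseteq J_1\subseteq\cdots\subseteq J_n=A$ such that each $J_i/J_{i-1}$ is a heredity ideal of $A/J_{i-1}$; here a two-sided ideal $J$ of a finite dimensional algebra $B$ with Jacobson radical $N$ is a heredity ideal if $J^2=J$, $JNJ=0$, and $J$ is projective as a left $B$-module. *)

(* Defs.v *)
From HB Require Import structures.
From mathcomp Require Import all_boot all_order all_algebra all_field.

Set Implicit Arguments.
Unset Strict Implicit.
Unset Printing Implicit Defensive.

Import GRing.Theory.
Local Open Scope ring_scope.

Definition zero_product_determined (F : fieldType) (A : falgType F) : Prop :=
  forall f : {biscalar A},
    (forall a b : A, a * b = 0 -> f a b = 0) ->
    exists Phi : {scalar A}, forall x y : A, f x y = Phi (x * y).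

Definition irreducible_module (R : pzRingType) (V : lmodType R) : Prop :=
  (exists v : V, v != 0) /\
  forall U : {pred V}, submod_closed U ->
    (forall v, v \in U -> v = 0) \/ (forall v, v \in U).

(* g : K -> V -> G is biadditive and F-balanced, where V is an F-vector space
   with scaling sc and F acts on K through iota. *)
Definition balanced (F K : fieldType) (iota : {rmorphism F -> K})
    (V : zmodType) (sc : F -> V -> V) (G : zmodType) (g : K -> V -> G) : Prop :=
  [/\ forall k l v, g (k + l) v = g k v + g l v,
      forall k u v, g k (u + v) = g k u + g k v &
      forall k c v, g (k * iota c) v = g k (sc c v)].

(* The pair (W, t) is a tensor product of K and V over F, with t k v in the role
   of the pure tensor of k and v (universal property). *)
Definition is_tensor (F K : fieldType) (iota : {rmorphism F -> K})
    (V : zmodType) (sc : F -> V -> V) (W : zmodType) (t : K -> V -> W) : Prop :=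
  balanced iota sc t /\
  forall (G : zmodType) (g : K -> V -> G), balanced iota sc g ->
    (exists h : {additive W -> G}, forall k v, h (t k v) = g k v) /\
    (forall h h' : {additive W -> G},
       (forall k v, h (t k v) = g k v) -> (forall k v, h' (t k v) = g k v) ->
       h =1 h').

(* For every field extension K of F, the module K (x) V over the ring K (x) A is
   irreducible. B is a model of K (x) A with its usual multiplication, and W a
   model of K (x) V with its usual action of B; such models always exist and are
   unique up to isomorphism, so the choice of the model is immaterial. *)
Definition absolutely_irreducible (F : fieldType) (A : falgType F)
    (V : lmodType A) : Prop :=
  irreducible_module V /\
  forall (K : fieldType) (iota : {rmorphism F -> K}),
    exists (B : pzRingType) (tA : K -> A -> B)
           (W : lmodType B) (tV : K -> V -> W),
      [/\ is_tensor iota (fun (c : F) (a : A) => c *: a) tA,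
          forall k l a b, tA k a * tA l b = tA (k * l) (a * b),
          is_tensor iota (fun (c : F) (v : V) => (c%:A : A) *: v) tV,
          forall k l a v, tA k a *: tV l v = tV (k * l) (a *: v) &
          irreducible_module W].

(* Irreducible modules over a finite dimensional algebra are finite
   dimensional, so no such condition is needed on V. *)
Definition splitting (F : fieldType) (A : falgType F) : Prop :=
  forall V : lmodType A, irreducible_module V -> absolutely_irreducible V.

Definition projective (R : pzRingType) (P : lmodType R) : Prop :=
  forall (M N : lmodType R) (g : {linear M -> N}) (f : {linear P -> N}),
    (forall y, exists x, g x = y) ->
    exists h : {linear P -> M}, forall p, g (h p) = f p.

(* There is a projective resolution
   0 -> P n -> ... -> P 1 -> P 0 -> M -> 0. *)
Definition proj_dim_le (R : pzRingType) (M : lmodType R) (n : nat) : Prop :=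
  exists (P : nat -> lmodType R) (d : forall i, {linear P i.+1 -> P i})
         (eps : {linear P 0%N -> M}),
    [/\ forall i, projective (P i),
        forall i, (n < i)%N -> forall x : P i, x = 0,
        forall m, exists x, eps x = m,
        forall x, eps x = 0 <-> exists y, d 0%N y = x &
        forall i x, d i x = 0 <-> exists y, d i.+1 y = x].

Definition finite_global_dimension (R : pzRingType) : Prop :=
  exists n : nat, forall M : lmodType R, proj_dim_le M n.

Definition cellular (F : fieldType) (A : falgType F) : Prop :=
  exists (disp : Order.disp_t) (L : finPOrderType disp) (M : L -> finType)
         (C : forall l : L, M l -> M l -> A) (star : {linear A -> A})
         (r : forall l : L, A -> M l -> M l -> F),
    let cell (u : {l : L & (M l * M l)%type}) :=
      C (tag u) (tagged u).1 (tagged u).2 in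
    let A_lt (l : L) : {vspace A} :=
      <<[seq cell u | u in [pred u | (tag u < l)%O]]>>%VS in
    [/\ basis_of fullv [seq cell u | u],
        (forall x y, star (x * y) = star y * star x) /\ involutive star,
        forall l s t, star (C l s t) = C l t s &
        forall a l s t,
          a * C l s t - \sum_(s' : M l) r l a s' s *: C l s' t \in A_lt l].

Section Ideals.
Variables (F : fieldType) (A : falgType F).
Implicit Types I J : {vspace A}.

Definition left_ideal I : bool := (fullv * I <= I)%VS.

Definition two_sided_ideal J : bool :=
  (fullv * J <= J)%VS && (J * fullv <= J)%VS.

Definition maximal_left_ideal I : Prop :=
  [/\ left_ideal I, I != fullv &
      forall I', left_ideal I' -> (I <= I')%VS -> I' = I \/ I' = fullv].

Definition in_jacobson_radical (x : A) : Prop :=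
  forall I, maximal_left_ideal I -> x \in I.

(* The left ideal J, seen as a left A-module, is projective; P is a copy of J
   as a module. *)
Definition projective_left_ideal J : Prop :=
  exists (P : lmodType A) (i : {linear P -> A^o}),
    [/\ projective P, injective i & forall x : A, x \in J <-> exists p, i p = x].

Definition heredity_ideal J : Prop :=
  [/\ two_sided_ideal J, (J * J)%VS = J,
      forall x z y, x \in J -> in_jacobson_radical z -> y \in J -> x * z * y = 0 &
      projective_left_ideal J].

End Ideals.

(* pi : A -> B presents B as the quotient algebra A / J. *)
Definition is_quotient (F : fieldType) (A B : falgType F) (J : {vspace A})
    (pi : {lrmorphism A -> B}) : Prop :=
  (forall b, exists a, pi a = b) /\ (forall a, pi a = 0 <-> a \in J).

(* When J i is all of A, the quotient by J i is the zero ring, which is not a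
   falgType; its zero ideal is a heredity ideal, so nothing is required then. *)
Definition quasi_hereditary (F : fieldType) (A : falgType F) : Prop :=
  exists (n : nat) (J : nat -> {vspace A}),
    [/\ J 0%N = 0%VS, J n = fullv,
        forall i, (i <= n)%N -> two_sided_ideal (J i),
        forall i, (i < n)%N -> (J i <= J i.+1)%VS &
        forall i, (i < n)%N -> J i != fullv ->
          exists (B : falgType F) (pi : {lrmorphism A -> B}),
            is_quotient (J i) pi /\ heredity_ideal (linfun pi @: J i.+1)%VS].

(* Main.v *)
Require Import Defs.
From HB Require Import structures.
From mathcomp Require Import all_boot all_order all_algebra all_field.
From mathcomp Require Import boolp.

Set Implicit Arguments.
Unset Strict Implicit.
Unset Printing Implicit Defensive.

Import GRing.Theory.
Local Open Scope ring_scope.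

(** The argument runs through idempotents. If a bilinear form f vanishes on zero
    products, the elements r with f (x r) y = f x (r y) for all x, y form a
    subalgebra. It contains every idempotent e, because
    x e (1 - e) y = 0 = x (1 - e) e y; and if it is all of A, then f x y is the
    linear function f (-) 1 of x y. So it is enough that no proper subalgebra E
    of A contains all idempotents ([idempotents_generate]).

    Such an E contains e a (1 - e) for every idempotent e, since
    e + e a (1 - e) is again idempotent. Splitting 1 into primitive idempotents
    reduces the claim to g A g <= E for g primitive. The ring g A g is local;
    let N be its ideal of nilpotent elements and J = g A (1 - g) A g, an ideal
    of g A g contained in E. If J is not inside N, then J = g A g. Otherwise
    P = {x | g x g in N} and Q = {x | g x g in N^2 + J} are two-sided ideals of
    A, A / P is a division algebra and P^2 <= Q. Two facts are needed:
    - A / P = F, so that g A g = F g + N ([residues_split]);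
    - the one-dimensional module A / P has no nonsplit extension by itself, so
      that N = N^2 + J ([no_self_extensions]).
    Nakayama's lemma turns the second one into N = J, whence g A g = F g + J <= E.

    The first fact holds for splitting algebras because an element d of A / P
    outside F gives the proper nonzero submodule {sum k (x) v | sum v k = 0} of
    K (x) A / P, with K = F[d] acting on A / P from the right. It holds for
    cellular algebras because a cell element C satisfies C a C = c C, with c a
    scalar, modulo lower cells; taking C outside P with all lower cells inside P
    and cancelling C shows that a C, hence every element, is a scalar modulo P.

    For the second fact in finite global dimension, note that a linear form that
    vanishes on Q is symmetric, tau (x y) = tau (y x), because A = F + P. By a
    theorem of Lenzing ([nilpotent_trace_eq0]) a symmetric form vanishes on
    nilpotent elements, while every element of P is nilpotent up to an element
    of Q. Lenzing's theorem is proved with Hattori-Stallings traces: an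
    endomorphism of a module of finite projective dimension has a well-defined
    trace, the alternating sum of the traces of its lifts to a resolution; this
    trace is additive on short exact sequences, hence zero on a nilpotent
    endomorphism, which is filtered by zero endomorphisms; and the trace of
    right multiplication by a on A is tau a.

    For a quasi-hereditary algebra, let J_i be the last layer of the heredity
    chain inside Q. The next layer is idempotent modulo J_i, hence not inside P,
    hence contains some 1 - p with p in P. For a in P and in the radical,
    (1 - p) a (1 - p) lies in J_i <= Q, and it equals a modulo P^2 <= Q. *)

(** * Submodules of free modules over a ring *)

Section RowModules.
Variable R : pzRingType.

Lemma row_choice m n (P : 'I_m -> 'rV[R]_n -> Prop) :
  (forall i, exists y, P i y) -> exists Y : 'M_(m, n), forall i, P i (row i Y).
Proof.
move=> /fin_all_exists[y Py]; exists (\matrix_(i, j) y i 0 j) => i.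
by have -> : row i (\matrix_(i, j) y i 0 j) = y i by apply/rowP=> j; rewrite !mxE.
Qed.

Lemma factor_rows m n k (X : 'M[R]_(m, n)) (D : 'M_(k, n)) :
  (forall i, exists y, row i X = y *m D) -> exists Y, X = Y *m D.
Proof.
move=> /row_choice[Y XY]; exists Y; apply/row_matrixP=> i.
by rewrite row_mul XY.
Qed.

Definition submodule (V : lmodType R) (K : V -> Prop) : Prop :=
  K 0 /\ forall a x y, K x -> K y -> K (a *: x + y).

Definition row_kernel m n (D : 'M[R]_(m, n)) : 'rV_m -> Prop :=
  fun y => y *m D = 0.

Definition row_space m n (D : 'M[R]_(m, n)) : 'rV_n -> Prop :=
  fun x => exists y, x = y *m D.

Definition generates m n (D : 'M[R]_(m, n)) (K : 'rV_n -> Prop) : Prop :=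
  forall x, K x <-> row_space D x.

Definition left_noetherian : Prop :=
  forall n (K : 'rV[R]_n -> Prop), submodule K ->
    exists m (D : 'M_(m, n)), generates D K.

Lemma submodule_row_kernel m n (D : 'M[R]_(m, n)) : submodule (row_kernel D).
Proof.
split=> [|a x y Kx Ky]; rewrite /row_kernel ?mul0mx //.
by rewrite mulmxDl -scalemxAl Kx Ky scaler0 addr0.
Qed.

Lemma submodule_row_space m n (D : 'M[R]_(m, n)) : submodule (row_space D).
Proof.
split=> [|a _ _ [x ->] [y ->]]; first by exists 0; rewrite mul0mx.
by exists (a *: x + y); rewrite mulmxDl scalemxAl.
Qed.

Lemma submoduleD (V : lmodType R) (K : V -> Prop) x y :
  submodule K -> K x -> K y -> K (x + y).
Proof. by case=> _ KD Kx Ky; rewrite -[x]scale1r; apply: KD. Qed.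

Lemma submoduleB (V : lmodType R) (K : V -> Prop) x y :
  submodule K -> K x -> K y -> K (x - y).
Proof. by case=> _ KD Kx Ky; rewrite addrC -scaleN1r; apply: KD. Qed.

Lemma submodule_mul m n (K : 'rV_n -> Prop) (Z : 'M_(m, n)) (y : 'rV_m) :
  submodule K -> (forall i, K (row i Z)) -> K (y *m Z).
Proof.
move=> subK KZ; rewrite mulmx_sum_row; have [K0 KD] := subK.
apply: (big_ind K) => // [x z Kx Kz|i _]; first exact: submoduleD.
by rewrite -[_ *: _]addr0; apply: KD.
Qed.

Lemma generates_row m n (D : 'M_(m, n)) (K : 'rV_n -> Prop) i :
  generates D K -> K (row i D).
Proof. by move=> DK; apply/DK; exists (delta_mx 0 i); rewrite rowE. Qed.
End RowModules.

(** * Traces of endomorphisms of modules of finite projective dimension *)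

Section EulerTrace.
Variables (R : pzRingType) (G : zmodType) (tau : {additive R -> G}).
Hypothesis tauC : forall x y, tau (x * y) = tau (y * x).

Definition mtr n (M : 'M[R]_n) : G := \sum_i tau (M i i).

Lemma mtr_mulC m n (X : 'M_(m, n)) (Y : 'M_(n, m)) :
  mtr (X *m Y) = mtr (Y *m X).
Proof.
rewrite /mtr.
under eq_bigr => i _ do rewrite mxE raddf_sum.
under [RHS]eq_bigr => i _ do rewrite mxE raddf_sum.
rewrite exchange_big; apply: eq_bigr => j _; apply: eq_bigr => i _; exact: tauC.
Qed.

Lemma mtr0 n : mtr (0 : 'M_n) = 0.
Proof. by rewrite /mtr big1 // => i _; rewrite mxE raddf0. Qed.

Lemma mtr_block m n (M1 : 'M_m) M2 M3 (M4 : 'M_n) :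
  mtr (block_mx M1 M2 M3 M4) = mtr M1 + mtr M4.
Proof.
rewrite /mtr big_split_ord /=; congr (_ + _); apply: eq_bigr => i _.
  by rewrite block_mxEul.
by rewrite block_mxEdr.
Qed.

(** [euler_trace n K U t] says that t is a value of the trace of the endomorphism
    U of the submodule K of a free module, computed from some resolution
      0 -> R^m E -> R^(m_(n-1)) -> ... -> R^(m_0) -> K -> 0
    by free modules, ending with a projective one, and from some lift of U. At
    each stage the rows of D generate K, so D is the covering R^m -> K and W
    lifts U along it. For n = 0, the matrix E is the projector of R^m onto the
    image of a section of D, which exhibits K as the projective module R^m E.
    Only submodules of free modules occur: this is enough for the syzygies and
    for all extensions below, and keeps endomorphisms in matrix form. *)
Fixpoint euler_trace (n l : nat) (K : 'rV[R]_l -> Prop) (U : 'M_l) (t : G) :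
    Prop :=
  if n is n'.+1 then
    exists m (D : 'M_(m, l)) (W : 'M_m) (s : G),
      [/\ generates D K, W *m D = D *m U,
          euler_trace n' (row_kernel D) W s & t = mtr W - s]
  else
    exists m (D : 'M_(m, l)) (E W : 'M_m),
      [/\ generates D K, E *m D = D,
          forall y, row_kernel D y -> row_kernel E y,
          W *m D = D *m U & t = mtr (E *m W)].

Lemma kernel_mx m n k p (D : 'M[R]_(m, n)) (E : 'M_(m, k)) (X : 'M_(p, m)) :
  (forall y, row_kernel D y -> row_kernel E y) -> X *m D = 0 -> X *m E = 0.
Proof.
move=> DE XD; apply/row_matrixP=> i; rewrite row_mul row0; apply: DE.
by rewrite /row_kernel -row_mul XD row0.
Qed.

Lemma generates_factor m n k (D : 'M[R]_(m, n)) K (X : 'M_(k, n)) :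
  generates D K -> (forall i, K (row i X)) -> exists Y, X = Y *m D.
Proof. by move=> DK KX; apply: factor_rows => i; apply/DK. Qed.

Lemma euler_trace_zero n l (K : 'rV_l -> Prop) U :
  (forall x, K x <-> x = 0) -> euler_trace n K U 0.
Proof.
have gen0 l' (K' : 'rV_l' -> Prop) :
    (forall x, K' x <-> x = 0) -> generates (0 : 'M_(0, l')) K'.
  move=> K0 x; split=> [/K0->|[y ->]]; first by exists 0; rewrite mulmx0.
  by apply/K0; rewrite mulmx0.
elim: n l K U => [|n IHn] l K U K0 /=.
  exists 0%N, 0, 0, 0; split=> //; rewrite ?mul0mx ?mulmx0 ?mtr0 //.
    exact: gen0.
  by move=> y _; rewrite /row_kernel mulmx0.
exists 0%N, 0, 0, 0; split; rewrite ?mul0mx ?mtr0 ?subr0 //; first exact: gen0.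
by apply: IHn => x; rewrite thinmx0 /row_kernel mul0mx; split.
Qed.

Lemma euler_trace_full n l (U : 'M_l) :
  euler_trace n (fun _ => True) U (mtr U).
Proof.
have gen1 : generates (1%:M : 'M[R]_l) (fun _ => True).
  by move=> x; split=> // _; exists x; rewrite mulmx1.
case: n => [|n] /=; first by exists l, 1%:M, 1%:M, U; split; rewrite ?mul1mx ?mulmx1.
exists l, 1%:M, U, 0; split=> //; rewrite ?mul1mx ?mulmx1 ?subr0 //.
by apply: euler_trace_zero => x; rewrite /row_kernel mulmx1.
Qed.

(** A short exact sequence 0 -> K1 -> K -> K2 -> 0 with compatible endomorphisms,
    whose maps J and Q are induced by matrices between the ambient free
    modules. *)
Record extension l1 l l2 (K1 : 'rV[R]_l1 -> Prop) (K : 'rV[R]_l -> Prop)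
    (K2 : 'rV[R]_l2 -> Prop) (U1 : 'M[R]_l1) (U : 'M[R]_l) (U2 : 'M[R]_l2)
    (J : 'M[R]_(l1, l)) (Q : 'M[R]_(l, l2)) : Prop := Extension {
  ext_submodule : submodule K;
  ext_stable : forall x, K x -> K (x *m U);
  ext_in : forall x, K1 x -> K (x *m J);
  ext_inj : forall x, K1 x -> x *m J = 0 -> x = 0;
  ext_complex : forall x, K1 x -> x *m J *m Q = 0;
  ext_exact : forall x, K x -> x *m Q = 0 -> exists2 y, K1 y & x = y *m J;
  ext_out : forall x, K x -> K2 (x *m Q);
  ext_surj : forall y, K2 y -> exists x, K x /\ x *m Q = y;
  ext_comml : forall x, K1 x -> x *m U1 *m J = x *m J *m U;
  ext_commr : forall x, K x -> x *m U *m Q = x *m Q *m U2 }.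

(** Coverings D1 of K1 and D2 of K2, the latter lifted to Z : R^m2 -> K, assemble
    into a covering of K, and the lifts W1, W2 into a block triangular lift: the
    difference between Z U and W2 Z dies in K2, hence comes from K1 and factors
    through D1. *)
Lemma horseshoe l1 l l2 m1 m2 (K1 : 'rV[R]_l1 -> Prop) (K : 'rV[R]_l -> Prop)
    (K2 : 'rV[R]_l2 -> Prop) (U1 : 'M_l1) (U : 'M_l) (U2 : 'M_l2)
    (J : 'M_(l1, l)) (Q : 'M_(l, l2)) (D1 : 'M_(m1, l1)) (D2 : 'M_(m2, l2))
    (Z : 'M_(m2, l)) (W1 : 'M_m1) (W2 : 'M_m2) :
  extension K1 K K2 U1 U U2 J Q ->
  generates D1 K1 -> generates D2 K2 -> (forall i, K (row i Z)) -> Z *m Q = D2 ->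
  W1 *m D1 = D1 *m U1 -> W2 *m D2 = D2 *m U2 ->
  generates (col_mx (D1 *m J) Z) K /\
  exists H, block_mx W1 0 H W2 *m col_mx (D1 *m J) Z = col_mx (D1 *m J) Z *m U.
Proof.
case=> subK KU JK _ JQ exK KQ _ U1J UQ gD1 gD2 KZ ZQ W1D W2D.
have KD1J i : K (row i (D1 *m J)).
  by rewrite row_mul; apply: JK; apply: generates_row.
split.
  move=> x; split=> [Kx|[y ->]]; last first.
    rewrite -[y]hsubmxK mul_row_col.
    by apply: submoduleD => //; apply: submodule_mul.
  have /gD2[y2 xQ] := KQ _ Kx.
  have [||y1 /gD1[z ->] /eqP] := exK (x - y2 *m Z).
  - by apply: submoduleB => //; apply: submodule_mul.
  - by rewrite mulmxBl -mulmxA ZQ xQ subrr.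
  rewrite subr_eq => /eqP ->; exists (row_mx z y2).
  by rewrite mul_row_col mulmxA.
have [||H HD] := @generates_factor _ _ _ (D1 *m J)
    (fun x => K x /\ x *m Q = 0) (Z *m U - W2 *m Z).
- move=> x; split=> [[Kx /(exK _ Kx)[y /gD1[z ->] ->]]|[y ->]].
    by exists z; rewrite mulmxA.
  split; first exact: submodule_mul.
  by rewrite !mulmxA JQ //; apply/gD1; exists y.
- move=> i; rewrite linearB /= !row_mul; split.
    by apply: submoduleB => //; [apply: KU|apply: submodule_mul].
  rewrite mulmxBl UQ // -!row_mul -!mulmxA ZQ W2D mulmxA ZQ.
  by rewrite subrr.
exists H; rewrite mul_block_col mul_col_mx mul0mx addr0 -HD subrK.
congr col_mx; rewrite mulmxA W1D; apply/row_matrixP=> i.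
by rewrite !row_mul U1J //; apply: generates_row.
Qed.

Lemma generates_lift l l2 m (K : 'rV[R]_l -> Prop) K2 (Q : 'M_(l, l2))
    (D2 : 'M_(m, l2)) :
  (forall y, K2 y -> exists x, K x /\ x *m Q = y) -> generates D2 K2 ->
  exists Z : 'M_(m, l), (forall i, K (row i Z)) /\ Z *m Q = D2.
Proof.
move=> surQ gD2.
have [i|Z KZ] := @row_choice _ m l (fun i x => K x /\ x *m Q = row i D2).
  by apply: surQ; apply: generates_row.
exists Z; split=> [i|]; first by case: (KZ i).
by apply/row_matrixP=> i; rewrite row_mul; case: (KZ i).
Qed.

(** The lift given by the horseshoe is block triangular, so its trace is the sum
    of the two traces; and the kernels of the coverings form an extension again. *)
Lemma euler_trace_ext n l1 l l2 (K1 : 'rV[R]_l1 -> Prop) (K : 'rV[R]_l -> Prop)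
    (K2 : 'rV[R]_l2 -> Prop) (U1 : 'M_l1) (U : 'M_l) (U2 : 'M_l2)
    (J : 'M_(l1, l)) (Q : 'M_(l, l2)) t1 t2 :
  extension K1 K K2 U1 U U2 J Q ->
  euler_trace n K1 U1 t1 -> euler_trace n K2 U2 t2 ->
  euler_trace n K U (t1 + t2).
Proof.
elim: n l1 l l2 K1 K K2 U1 U U2 J Q t1 t2 =>
  [|n IHn] l1 l l2 K1 K K2 U1 U U2 J Q t1 t2 /=.
  move=> ext [m1 [D1 [E1 [W1 [gD1 E1D kE1 W1D ->]]]]].
  move=> [m2 [D2 [E2 [W2 [gD2 E2D kE2 W2D ->]]]]].
  have [Z0 [KZ0 Z0Q]] := generates_lift (ext_surj ext) gD2.
  have subK := ext_submodule ext.
  (* Replacing Z0 by E2 Z0 makes Z vanish on the kernel of D2: it is induced by *)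
  (* a splitting K2 -> K, so that the block diagonal projector fits D. *)
  pose Z := E2 *m Z0.
  have KZ i : K (row i Z) by rewrite row_mul; apply: submodule_mul.
  have ZQ : Z *m Q = D2 by rewrite -mulmxA Z0Q.
  have [gD [H HD]] := horseshoe ext gD1 gD2 KZ ZQ W1D W2D.
  have E2E : E2 *m E2 = E2.
    apply/eqP; rewrite -subr_eq0 -[X in _ - X]mul1mx -mulmxBl; apply/eqP.
    by apply: (kernel_mx kE2); rewrite mulmxBl mul1mx E2D subrr.
  exists (m1 + m2)%N, (col_mx (D1 *m J) Z), (block_mx E1 0 0 E2),
    (block_mx W1 0 H W2).
  split=> //.
  - by rewrite mul_block_col !mul0mx addr0 add0r !mulmxA E1D E2E.
  - move=> y; rewrite /row_kernel -[y]hsubmxK mul_row_col mul_row_block !mulmx0.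
    rewrite addr0 add0r => y0; have yE2: rsubmx y *m E2 = 0.
      apply: kE2; rewrite /row_kernel -ZQ mulmxA.
      have /(congr1 (fun z => z *m Q)) := y0.
      rewrite mulmxDl mul0mx [_ *m (D1 *m J)]mulmxA (ext_complex ext) ?add0r //.
      by apply/gD1; exists (lsubmx y).
    move: y0; rewrite [_ *m Z]mulmxA yE2 mul0mx addr0 mulmxA => yD1.
    rewrite (kE1 (lsubmx y)) ?row_mx0 //.
    by apply: (ext_inj ext) => //; apply/gD1; exists (lsubmx y).
  - by rewrite mulmx_block !mul0mx !mulmx0 !addr0 !add0r mtr_block.
move=> ext [m1 [D1 [W1 [s1 [gD1 W1D tr1 ->]]]]].
move=> [m2 [D2 [W2 [s2 [gD2 W2D tr2 ->]]]]].
have [Z [KZ ZQ]] := generates_lift (ext_surj ext) gD2.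
have subK := ext_submodule ext.
have [gD [H HD]] := horseshoe ext gD1 gD2 KZ ZQ W1D W2D.
exists (m1 + m2)%N, (col_mx (D1 *m J) Z), (block_mx W1 0 H W2), (s1 + s2).
split=> //; last by rewrite mtr_block opprD addrACA.
apply: (IHn _ _ _ _ _ _ _ _ _ (row_mx 1%:M 0) (col_mx 0 1%:M) _ _ _ tr1 tr2).
split.
- exact: submodule_row_kernel.
- by move=> x Kx; rewrite /row_kernel -mulmxA HD mulmxA Kx mul0mx.
- move=> x Kx; rewrite /row_kernel mul_mx_row mulmx1 mulmx0 mul_row_col mul0mx.
  by rewrite addr0 mulmxA Kx mul0mx.
- move=> x _; rewrite mul_mx_row mulmx1 mulmx0 => /(congr1 lsubmx).
  by rewrite row_mxKl linear0.
- by move=> x _; rewrite mul_mx_row mul_row_col !mulmx0 mul0mx addr0.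
- move=> x; rewrite -[x]hsubmxK /row_kernel mul_row_col => Kx.
  rewrite mul_row_col mulmx0 add0r mulmx1 => x20; exists (lsubmx x).
    move: Kx; rewrite x20 mul0mx addr0 mulmxA; apply: (ext_inj ext).
    by apply/gD1; exists (lsubmx x).
  by rewrite x20 mul_mx_row mulmx1 mulmx0.
- move=> x; rewrite -[x]hsubmxK /row_kernel mul_row_col => Kx.
  rewrite mul_row_col mulmx0 add0r mulmx1 -ZQ mulmxA.
  have /(congr1 (fun z => z *m Q)) := Kx.
  rewrite mulmxDl mul0mx [_ *m (D1 *m J)]mulmxA (ext_complex ext) ?add0r //.
  by apply/gD1; exists (lsubmx x).
- move=> y Ky; have [||y1 /gD1[z ->] yZ] := ext_exact ext (x := y *m Z).
  + exact: submodule_mul.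
  + by rewrite -mulmxA ZQ.
  exists (row_mx (- z) y); rewrite /row_kernel !mul_row_col yZ mulmxA.
  by rewrite -mulmxDl mulNmx addNr mul0mx mulmx0 mulmx1 add0r.
- move=> x _; rewrite !mul_mx_row mul_row_block !mulmx1 !mulmx0 !mul0mx !addr0.
  by [].
- move=> x _; rewrite -[x]hsubmxK mul_row_block !mul_row_col !mulmx0 mulmx1.
  by rewrite mulmx1 !add0r.
Qed.

(** Two coverings D and D' of K are compared through their pullback
    Z = {(x, y) | x D = y D'}, following Schanuel: Z is an extension of R^m' by
    ker D and of R^m by ker D', so its trace, unique by induction, can be
    computed in two ways. *)
Lemma euler_trace_uniq n l (K : 'rV[R]_l -> Prop) (U : 'M_l) t t' :
  euler_trace n K U t -> euler_trace n K U t' -> t = t'.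
Proof.
elim: n l K U t t' => [|n IHn] l K U t t' /=.
  move=> [m [D [E [W [gD ED kE WD ->]]]]].
  move=> [m' [D' [E' [W' [gD' ED' kE' WD' ->]]]]].
  have [X D'E] := generates_factor gD (fun i => generates_row i gD').
  have [Y DE] := generates_factor gD' (fun i => generates_row i gD).
  have EE : E *m E = E.
    apply/eqP; rewrite -subr_eq0 -[X in _ - X]mul1mx -mulmxBl; apply/eqP.
    by apply: (kernel_mx kE); rewrite mulmxBl mul1mx ED subrr.
  (* a and b are inverse isomorphisms between the two projective covers. *)
  pose a := E *m Y; pose b := E' *m X *m E.
  have aD : a *m D' = D by rewrite /a -mulmxA -DE ED.
  have bD : b *m D = D' by rewrite /b -!mulmxA ED -D'E ED'.
  have bE : b *m E = b by rewrite /b -mulmxA EE.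
  clearbody a b.
  have abE : a *m b = E.
    apply/eqP; rewrite -subr_eq0; apply/eqP.
    have <- : (a *m b - E) *m E = a *m b - E.
      by rewrite mulmxBl EE -mulmxA bE.
    by apply: (kernel_mx kE); rewrite mulmxBl ED -mulmxA bD aD subrr.
  have bWa : b *m W *m a *m E' = W' *m E'.
    apply/eqP; rewrite -subr_eq0 -mulmxBl; apply/eqP; apply: (kernel_mx kE').
    by rewrite mulmxBl -(mulmxA _ a) aD -(mulmxA b) WD WD' mulmxA bD subrr.
  rewrite (mtr_mulC E') -bWa -(mtr_mulC E') !mulmxA.
  have -> : E' *m b = b.
    apply/eqP; rewrite -subr_eq0; apply/eqP.
    have <- : (E' *m b - b) *m E = E' *m b - b.
      by rewrite mulmxBl -mulmxA bE.
    by apply: (kernel_mx kE); rewrite mulmxBl -mulmxA bD ED' subrr.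
  by rewrite (mtr_mulC _ a) !mulmxA abE.
move=> [m [D [W [s [gD WD trs ->]]]]] [m' [D' [W' [s' [gD' WD' trs' ->]]]]].
pose Z := row_kernel (col_mx D (- D')).
have ZE x : Z x <-> lsubmx x *m D = rsubmx x *m D'.
  rewrite /Z /row_kernel -{1}[x]hsubmxK mul_row_col mulmxN; split=> /eqP.
    by rewrite subr_eq0 => /eqP.
  by move=> ?; apply/eqP; rewrite subr_eq0.
have subZ : submodule Z by apply: submodule_row_kernel.
have stZ x : Z x -> Z (x *m block_mx W 0 0 W').
  move=> /ZE xD; apply/ZE; rewrite -[x]hsubmxK mul_row_block !mulmx0 addr0 add0r.
  by rewrite row_mxKl row_mxKr -!mulmxA WD WD' !mulmxA xD.
have X1 : euler_trace n Z (block_mx W 0 0 W') (s + mtr W').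
  apply: (@euler_trace_ext n m _ m' _ _ (fun=> True) _ _ W' (row_mx 1%:M 0)
    (col_mx 0 1%:M) _ _ _ trs (euler_trace_full n W')).
  split=> //.
  - move=> x Kx; apply/ZE; rewrite mul_mx_row mulmx1 mulmx0 row_mxKl row_mxKr.
    by rewrite mul0mx.
  - move=> x _; rewrite mul_mx_row mulmx1 mulmx0 => /(congr1 lsubmx).
    by rewrite row_mxKl linear0.
  - by move=> x _; rewrite mul_mx_row mul_row_col !mulmx0 mul0mx addr0.
  - move=> x /ZE; rewrite -[x]hsubmxK mul_row_col mulmx0 add0r mulmx1.
    rewrite row_mxKl row_mxKr => xD x20; exists (lsubmx x).
      by rewrite /row_kernel xD x20 mul0mx.
    by rewrite mul_mx_row mulmx1 mulmx0 x20.
  - move=> y _; have /gD[x xy] : K (y *m D') by apply/gD'; exists y.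
    exists (row_mx x y); split; first by apply/ZE; rewrite row_mxKl row_mxKr.
    by rewrite mul_row_col mulmx0 add0r mulmx1.
  - by move=> x _; rewrite !mul_mx_row mul_row_block !mulmx1 !mulmx0 !mul0mx !addr0.
  - move=> x _; rewrite -[x]hsubmxK mul_row_block !mul_row_col !mulmx0 mulmx1.
    by rewrite mulmx1 !add0r.
have X2 : euler_trace n Z (block_mx W 0 0 W') (s' + mtr W).
  apply: (@euler_trace_ext n m' _ m _ _ (fun=> True) _ _ W (row_mx 0 1%:M)
    (col_mx 1%:M 0) _ _ _ trs' (euler_trace_full n W)).
  split=> //.
  - move=> x Kx; apply/ZE; rewrite mul_mx_row mulmx1 mulmx0 row_mxKl row_mxKr.
    by rewrite mul0mx.
  - move=> x _; rewrite mul_mx_row mulmx1 mulmx0 => /(congr1 rsubmx).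
    by rewrite row_mxKr linear0.
  - by move=> x _; rewrite mul_mx_row mul_row_col !mulmx0 mul0mx add0r.
  - move=> x /ZE; rewrite -[x]hsubmxK mul_row_col mulmx0 addr0 mulmx1.
    rewrite row_mxKl row_mxKr => xD x20; exists (rsubmx x).
      by rewrite /row_kernel -xD x20 mul0mx.
    by rewrite mul_mx_row mulmx1 mulmx0 x20.
  - move=> y _; have /gD'[x xy] : K (y *m D) by apply/gD; exists y.
    exists (row_mx y x); split; first by apply/ZE; rewrite row_mxKl row_mxKr.
    by rewrite mul_row_col mulmx0 addr0 mulmx1.
  - by move=> x _; rewrite !mul_mx_row mul_row_block !mulmx1 !mulmx0 !mul0mx !add0r.
  - move=> x _; rewrite -[x]hsubmxK mul_row_block !mul_row_col !mulmx0 mulmx1.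
    by rewrite mulmx1 !addr0.
apply/eqP; rewrite subr_eq addrAC eq_sym subr_eq; apply/eqP.
by rewrite addrC (IHn _ _ _ _ _ X1 X2) addrC.
Qed.

(** Multiplication by a acts on K_j = {x | x a^j = 0}, and the quotient of K_(j+1)
    by K_j, realised as the image L of K_(j+1) under a^j, carries the zero
    endomorphism. By additivity the trace on every K_j is 0; for a^m = 0 this is
    the trace on K_m = R, which is also tau a. *)
Lemma nilpotent_trace n :
  (forall l (K : 'rV[R]_l -> Prop), submodule K -> euler_trace n K 0 0) ->
  forall a m, a ^+ m = 0 -> tau a = 0.
Proof.
move=> zero_trace a m am0.
pose aM k : 'M[R]_1 := (a ^+ k)%:M.
have aMS k : aM k.+1 = aM k *m aM 1%N by rewrite /aM -scalar_mxM -exprSr.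
have aMSl k : aM k.+1 = aM 1%N *m aM k by rewrite /aM -scalar_mxM -exprS.
have kerD k : submodule (row_kernel (aM k)) by apply: submodule_row_kernel.
have step k : euler_trace n (row_kernel (aM k)) (aM 1%N) 0.
  elim: k => [|k IHk].
    by apply: euler_trace_zero => x; rewrite /row_kernel mulmx1; split.
  pose L y := exists x, row_kernel (aM k.+1) x /\ y = x *m aM k.
  have subL : submodule L.
    have [K0 KD] := kerD k.+1.
    split=> [|c _ _ [x [Kx ->]] [y [Ky ->]]]; first by exists 0; rewrite mul0mx.
    by exists (c *: x + y); rewrite mulmxDl scalemxAl; split; first exact: KD.
  rewrite -[0]addr0.
  apply: (@euler_trace_ext n 1 1 1 _ _ L _ _ 0 1%:M (aM k) _ _ _ IHk
    (zero_trace _ _ subL)).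
  split=> //.
  - move=> x Kx; by rewrite /row_kernel -mulmxA -aMSl aMS mulmxA Kx mul0mx.
  - by move=> x Kx; rewrite mulmx1 /row_kernel aMS mulmxA Kx mul0mx.
  - by move=> x _; rewrite mulmx1.
  - by move=> x Kx; rewrite mulmx1.
  - by move=> x _ Kx; exists x; rewrite ?mulmx1.
  - by move=> x Kx; exists x.
  - by move=> _ [x [Kx ->]]; exists x.
  - by move=> x _; rewrite !mulmx1.
  - by move=> x Kx; rewrite mulmx0 -mulmxA -aMSl.
have full : euler_trace n (row_kernel (aM m)) (aM 1%N) (tau a).
  have -> : tau a = mtr (aM 1%N) by rewrite /mtr big_ord1 mxE expr1.
  have -> : row_kernel (aM m) = (fun=> True); last exact: euler_trace_full.
  apply/funext=> x; apply/propext; split=> // _.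
  by rewrite /row_kernel /aM am0 raddf0 mulmx0.
exact: euler_trace_uniq full (step m).
Qed.
End EulerTrace.

(** * Submodules as modules *)

Section SubmoduleType.
Variables (R : pzRingType) (V : lmodType R) (K : V -> Prop).

Record submod_sub := SubmodSub { submod_val : V; _ : `[< K submod_val >] }.

(** The closure proof is a parameter of the type so that the module structure can
    be declared once for all predicates. *)
Definition submod (_ : submodule K) := submod_sub.

Variable subK : submodule K.

Lemma submod_closedP : subsemimod_closed (fun x : V => `[< K x >]).
Proof.
have [K0 _] := subK; split; first split.
- exact/asboolP.
- by move=> x y /asboolP Kx /asboolP Ky; apply/asboolP; apply: submoduleD.
- move=> a x /asboolP Kx; apply/asboolP; rewrite -[_ *: _]addr0.
  by case: subK => _; apply.
Qed.

HB.instance Definition _ := [isSub for submod_val].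
HB.instance Definition _ := [Choice of submod_sub by <:].
HB.instance Definition _ := SubChoice.on (submod subK).
HB.instance Definition _ :=
  GRing.SubChoice_isSubLmodule.Build R V _ (submod subK) submod_closedP.

Lemma submodP (x : submod subK) : K (val x).
Proof. exact/asboolP/(valP x). Qed.

Lemma submod_factor (U : lmodType R) (f : {linear U -> V}) :
  (forall u, K (f u)) ->
  exists f' : {linear U -> submod subK}, forall u, val (f' u) = f u.
Proof.
move=> Kf; pose f' u : submod subK := SubmodSub (asboolT (Kf u)).
have lin_f' : linear f'.
  by move=> a u v; apply: val_inj; rewrite linearP /= linearP.
pose F : {linear U -> submod subK} :=
  HB.pack f' (GRing.isLinear.Build _ _ _ _ f' lin_f').
by exists F.
Qed.
End SubmoduleType.

(** * Syzygies in finite global dimension *)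

Section Syzygies.
Variable R : pzRingType.

Section Combination.
Variables (V : lmodType R) (m : nat) (v : 'I_m -> V).
Definition combination (x : 'rV[R]_m) : V := \sum_i x 0 i *: v i.

Lemma combination_linear : linear combination.
Proof.
move=> a x y; rewrite /combination scaler_sumr -big_split /=.
by apply: eq_bigr => i _; rewrite !mxE scalerDl scalerA.
Qed.
HB.instance Definition _ :=
  GRing.isLinear.Build R 'rV[R]_m V _ combination combination_linear.
End Combination.

Lemma linear_combination (V : lmodType R) m (f : {linear 'rV[R]_m -> V}) x :
  f x = combination (fun i => f (delta_mx 0 i)) x.
Proof.
by rewrite {1}(row_sum_delta x) linear_sum; apply: eq_bigr => i _; rewrite linearZ.
Qed.

Lemma factor_linear m n k (D : 'M[R]_(k, n)) (f : {linear 'rV[R]_m -> 'rV[R]_n}) :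
  (forall x, row_space D (f x)) -> exists H, forall x, f x = x *m H *m D.
Proof.
move=> Df; have [i|H fH] := @row_choice _ m k (fun i y => f (delta_mx 0 i) = y *m D).
  exact: Df.
exists H => x; rewrite linear_combination (mulmx_sum_row x H) mulmx_suml.
by apply: eq_bigr => i _; rewrite fH scalemxAl.
Qed.

(** The projectivity property lifts along surjections of modules; here it is
    applied to the surjection of R^m onto the row space of D. *)
Lemma projective_lift (P : lmodType R) m n (D : 'M[R]_(m, n))
    (f : {linear P -> 'rV[R]_n}) :
  projective P -> (forall p, row_space D (f p)) ->
  exists g : {linear P -> 'rV_m}, forall p, g p *m D = f p.
Proof.
move=> projP Df; have subD := submodule_row_space D.
have [f' f'E] := submod_factor subD Df.
have [y|D' D'E] := submod_factor (f := mulmxr D) subD.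
  by exists y.
have [y|g gE] := projP _ _ D' f'.
  have [x yx] := submodP y; exists x; apply: val_inj.
  by rewrite D'E yx.
by exists g => p; rewrite -f'E -gE D'E.
Qed.

Variables (G : zmodType) (tau : {additive R -> G}).
Hypothesis noethR : left_noetherian R.

(** A projective resolution P of a module and a resolution X of it by finitely
    generated free modules are compared degree by degree. Here f : X_i -> P_i and
    g : P_i -> X_i belong to chain maps lifting the identity, and h : X_(i-1) -> X_i
    to a homotopy between g f and the identity, D being the differential of X.
    They can be continued as long as P lasts. When P_(i+1) = 0, the homotopy
    D' h' D' = D' shows that the next syzygy is the image of a projector of
    X_(i+1). The trace of the zero endomorphism stands for the statement that
    the i-th syzygy has a finite resolution. *)
Lemma syzygy_step n (P : nat -> lmodType R)
    (d : forall i, {linear P i.+1 -> P i})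
    m l (D : 'M[R]_(m, l)) (f : {linear 'rV[R]_m -> P 0%N})
    (g : {linear P 0%N -> 'rV[R]_m}) (h : 'M_(l, m)) :
  (forall i, projective (P i)) ->
  (forall i, (n < i)%N -> forall x : P i, x = 0) ->
  (forall i x, d i x = 0 <-> exists y, d i.+1 y = x) ->
  (forall x, row_kernel D x -> exists y, d 0%N y = f x) ->
  (forall y, row_kernel D (g (d 0%N y))) ->
  (forall x, row_kernel D (x - g (f x) - x *m D *m h)) ->
  euler_trace tau n (row_kernel D) 0 0.
Proof.
elim: n P d m l D f g h => [|n IHn] P d m l D f g h projP P0 exP fD gD hD /=.
all: have [m' [D' gD']] := noethR (submodule_row_kernel D).
all: have D'D : D' *m D = 0.
1,3: apply/row_matrixP => i; rewrite row_mul row0; exact: generates_row gD'.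
all: pose r : {linear 'rV[R]_m -> 'rV[R]_m} := idfun \- (g \o f) \- mulmxr (D *m h).
all: have rE x : r x = x - g (f x) - x *m D *m h by rewrite /r /= mulmxA.
all: have [x|h' h'E] := @factor_linear _ _ _ D' r; first by apply/gD'; rewrite rE.
  (* P 1 = 0 forces f to vanish on the kernel of D, so D' h' D' = D'. *)
  exists m', D', (D' *m h'), 0; split; rewrite ?mul0mx ?mulmx0 ?mtr0 //.
    apply/row_matrixP => i; rewrite !row_mul -h'E rE.
    have Di : row_kernel D (row i D') by apply: generates_row gD'.
    have [y <-] := fD _ Di; rewrite (P0 1%N isT y) !linear0 Di mul0mx.
    by rewrite oppr0 !addr0.
  by move=> y; rewrite /row_kernel mulmxA => ->; rewrite mul0mx.
exists m', D', 0, 0; split; rewrite ?mul0mx ?mulmx0 ?mtr0 ?subr0 //.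
have /fin_all_exists[v vE] : forall i, exists y, d 0%N y = f (row i D').
  by move=> i; apply: fD; apply: generates_row gD'.
have f'E x : d 0%N (combination v x) = f (x *m D').
  rewrite (linear_sum (d 0%N)) mulmx_sum_row linear_sum; apply: eq_bigr => i _.
  by rewrite !linearZ vE.
have [p|g' g'E] := @projective_lift (P 1%N) _ _ D' (g \o d 0%N) (projP 1%N).
  exact/gD'/gD.
apply: (IHn (fun i => P i.+1) (fun i => d i.+1) _ _ D' (combination v) g' h').
- by move=> i; apply: projP.
- by move=> i ni; apply: P0.
- by move=> i; apply: exP.
- by move=> x Kx; apply/exP; rewrite f'E Kx linear0.
- move=> y; rewrite /row_kernel g'E /=.
  by have /exP-> : exists z, d 1%N z = d 1%N y; [exists y | rewrite linear0].
- move=> x; rewrite /row_kernel !mulmxBl g'E /= f'E -h'E rE.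
  by rewrite -(mulmxA x) D'D mulmx0 mul0mx subr0 subrr.
Qed.

Lemma euler_trace_zero_endo :
  finite_global_dimension R ->
  exists n, forall l (K : 'rV[R]_l -> Prop), submodule K -> euler_trace tau n K 0 0.
Proof.
move=> [n gldim]; exists n.+1 => l K subK.
have [P [d [eps [projP P0 surj exP0 exP]]]] := gldim (submod subK).
have [m [D gD]] := noethR subK.
have /fin_all_exists[v vE] : forall i, exists y, val (eps y) = row i D.
  move=> i; have [y epsy] := surj (SubmodSub (asboolT (generates_row i gD))).
  by exists y; rewrite epsy.
have valE (y : P 0%N) : val (eps y) = (val \o eps : {linear _ -> _}) y by [].
have fE x : val (eps (combination v x)) = x *m D.
  rewrite valE (linear_sum (val \o eps : {linear _ -> _})) mulmx_sum_row.
  by apply: eq_bigr => i _; rewrite linearZ /= vE.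
have [p|g gE] := @projective_lift _ _ _ D (val \o eps : {linear _ -> _}) (projP 0%N).
  by apply/gD; apply: submodP.
exists m, D, 0, 0; split; rewrite ?mul0mx ?mulmx0 ?mtr0 ?subr0 //.
apply: (@syzygy_step n P d _ _ D (combination v) g 0) => //.
- by move=> x Kx; apply/exP0/val_inj; rewrite fE Kx linear0.
- move=> y; rewrite /row_kernel gE /=.
  by have /exP0-> : exists z, d 0%N z = d 0%N y by exists y.
- move=> x; rewrite /row_kernel mulmx0 subr0 mulmxBl gE /= fE subrr //.
Qed.
End Syzygies.

(** Lenzing's theorem, of which the statement for the universal symmetric map
    R -> R / [R, R] says that nilpotent elements are sums of commutators. *)
Theorem nilpotent_trace_eq0 (R : pzRingType) (G : zmodType)
    (tau : {additive R -> G}) (a : R) m :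
  left_noetherian R -> finite_global_dimension R ->
  (forall x y, tau (x * y) = tau (y * x)) -> a ^+ m = 0 -> tau a = 0.
Proof.
move=> noethR gldim tauC.
have [n zero_trace] := euler_trace_zero_endo tau noethR gldim.
move=> am0; exact (nilpotent_trace tauC zero_trace am0).
Qed.

(** * Linear algebra in finite-dimensional algebras *)

Section FiniteDimension.
Variable F : fieldType.

Lemma vspace_of_submodule (V : vectType F) (S : V -> Prop) :
  submodule S -> exists U : {vspace V}, forall x, x \in U <-> S x.
Proof.
move=> subS; have [S0 SD] := subS.
pose p (n : nat) := `[< exists U : {vspace V}, \dim U = n /\ forall x, x \in U -> S x >].
have p0 : exists n : nat, p n.
  exists 0%N; apply/asboolP; exists 0%VS; rewrite dimv0; split=> // x.
  by rewrite memv0 => /eqP->.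
have ple (n : nat) : p n -> (n <= \dim {:V})%N.
  by move=> /asboolP[U [<- _]]; rewrite dimvS ?subvf.
case: (ex_maxnP p0 ple) => n /asboolP[U [dU US]] nmax.
exists U => x; split=> [|Sx]; first exact: US.
have dUx : (\dim (U + <[x]>) <= \dim U)%N.
  rewrite dU; apply: nmax; apply/asboolP; exists (U + <[x]>)%VS; split=> // y.
  move=> /memv_addP[u Uu [_ /vlineP[c ->] ->]].
  by rewrite addrC; apply: SD => //; apply: US.
have /eqP -> : (U == U + <[x]>)%VS by rewrite eqEdim addvSl.
by rewrite memvE addvSr.
Qed.

Lemma separating_functional (V : vectType F) (U : {vspace V}) (v : V) :
  v \notin U -> exists f : {scalar V}, f v = 1 /\ forall u, u \in U -> f u = 0.
Proof.
move=> Uv; pose p := daddv_pi U^C U v.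
have capU : (U :&: U^C = 0)%VS by rewrite capv_compl.
have capU' : (U^C :&: U = 0)%VS by rewrite capvC.
have p0 : p != 0.
  apply: contraNneq Uv => p0; rewrite -(daddv_pi_add capU (w := v)).
    by rewrite -/p p0 addr0 memv_pi.
  by rewrite addv_complf memvf.
have free_p : free [tuple p] by rewrite seq1_free.
pose f : {scalar V} := coord [tuple p] ord0 \o daddv_pi U^C U.
exists f; split=> [|u Uu] /=.
  have -> : daddv_pi U^C U v = [tuple p]`_(ord0 : 'I_1) by [].
  by rewrite coord_free ?eqxx.
suff -> : daddv_pi U^C U u = 0 by rewrite linear0.
have := daddv_pi_add capU (w := u); rewrite addv_complf memvf => /(_ isT).
by rewrite (daddv_pi_id capU Uu) -[RHS]addr0 => /addrI.
Qed.

Variable A : falgType F.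

Lemma falg_noetherian : left_noetherian A.
Proof.
move=> n K [K0 KD]; pose rowof (v : {ffun 'I_n -> A}) : 'rV[A]_n := \row_j v j.
have [|U UK] := @vspace_of_submodule {ffun 'I_n -> A} (fun v => K (rowof v)).
  split=> [|c u v Ku Kv].
    by have -> : rowof 0 = 0; [apply/rowP=> j; rewrite !mxE ffunE | exact: K0].
  have -> : rowof (c *: u + v) = c%:A *: rowof u + rowof v.
    by apply/rowP=> j; rewrite !mxE !ffunE -scalerAl mul1r.
  exact: KD.
pose D := \matrix_(i < \dim U) rowof (vbasis U)`_i.
have DE i : row i D = rowof (vbasis U)`_i by rewrite rowK.
exists (\dim U), D => x; split=> [Kx|[y ->]]; last first.
  apply: (submodule_mul _ (conj K0 KD)) => i; rewrite DE; apply/UK.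
  by rewrite vbasis_mem ?mem_nth ?size_tuple.
pose v : {ffun 'I_n -> A} := [ffun j => x 0 j].
have vx : rowof v = x by apply/rowP=> j; rewrite mxE ffunE.
have Uv : v \in U by apply/UK; rewrite vx.
exists (\row_i (coord (vbasis U) i v)%:A); rewrite mulmx_sum_row.
rewrite -{1}vx {1}(coord_vbasis Uv); apply/rowP=> j.
rewrite summxE mxE sum_ffunE; apply: eq_bigr => i _.
by rewrite DE !mxE !ffunE -scalerAl mul1r.
Qed.
End FiniteDimension.

(** * Primitive idempotents and their local corners *)

Section Idempotents.
Variables (F : fieldType) (A : falgType F).
Implicit Types (x y g e : A) (U N J : {vspace A}).

Definition nilpotent x : Prop := exists m, x ^+ m = 0.

Lemma stationary_double (f : nat -> nat) :
  (forall j k, (j <= k)%N -> (f k <= f j)%N) ->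
  exists2 k, (0 < k)%N & f (k + k)%N = f k.
Proof.
move=> f_noninc; suff: forall b k, (0 < k)%N -> (f k <= b)%N ->
    exists2 k, (0 < k)%N & f (k + k)%N = f k by move/(_ (f 1%N) 1%N isT (leqnn _)).
elim=> [|b IHb] k k0 fkb.
  exists k => //; apply/eqP; rewrite eqn_leq f_noninc ?leq_addr //.
  by rewrite (leq_trans fkb).
have [fkk|] := eqVneq (f (k + k)%N) (f k); first by exists k.
rewrite neq_ltn => /orP[fkk|]; last by rewrite ltnNge f_noninc ?leq_addr.
apply: (IHb (k + k)%N); first by rewrite addn_gt0 k0.
by rewrite -ltnS (leq_trans fkk).
Qed.

(** Fitting's lemma in ring form: the decreasing chains A x^k and x^k A are
    stationary, so x^k = c x^(2k) = x^(2k) d for some k, and then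
    e = c x^k = x^k d is the projector onto the part where x is invertible. *)
Lemma power_idempotent x :
  exists k c d e, [/\ (0 < k)%N, e * e = e, x ^+ k * e = x ^+ k,
    e = c * x ^+ k & e = x ^+ k * d].
Proof.
pose Lk k := (amulr (x ^+ k) @: fullv)%VS; pose Rk k := (amull (x ^+ k) @: fullv)%VS.
have Lle j k : (j <= k)%N -> (Lk k <= Lk j)%VS.
  move=> jk; apply/subvP=> _ /memv_imgP[u _ ->].
  rewrite lfunE /= -(subnK jk) exprD mulrA; apply/memv_imgP.
  by exists (u * x ^+ (k - j)); rewrite ?memvf // lfunE.
have Rle j k : (j <= k)%N -> (Rk k <= Rk j)%VS.
  move=> jk; apply/subvP=> _ /memv_imgP[u _ ->].
  rewrite lfunE /= -(subnKC jk) exprD -mulrA; apply/memv_imgP.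
  by exists (x ^+ (k - j) * u); rewrite ?memvf // lfunE.
have [j k jk|k k0] := @stationary_double (fun k => \dim (Lk k) + \dim (Rk k))%N.
  by rewrite leq_add ?dimvS ?Lle ?Rle.
have dL : (\dim (Lk (k + k)) <= \dim (Lk k))%N by rewrite dimvS ?Lle ?leq_addr.
have dR : (\dim (Rk (k + k)) <= \dim (Rk k))%N by rewrite dimvS ?Rle ?leq_addr.
move=> dLR.
have eL : Lk (k + k)%N == Lk k.
  by rewrite eqEdim Lle ?leq_addr //= -(leq_add2r (\dim (Rk k))) -dLR leq_add2l.
have eR : Rk (k + k)%N == Rk k.
  by rewrite eqEdim Rle ?leq_addr //= -(leq_add2l (\dim (Lk k))) -dLR leq_add2r.
have /memv_imgP[c _] : x ^+ k \in Lk (k + k)%N.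
  rewrite (eqP eL); apply/memv_imgP; exists 1; rewrite ?memvf //.
  by rewrite lfunE /= mul1r.
have /memv_imgP[d _] : x ^+ k \in Rk (k + k)%N.
  rewrite (eqP eR); apply/memv_imgP; exists 1; rewrite ?memvf //.
  by rewrite lfunE /= mulr1.
rewrite !lfunE /= exprD; set y := x ^+ k => yd yc.
have ecd : c * y = y * d by rewrite {1}yd mulrA -yc.
exists k, c, d, (c * y); split; rewrite -/y //.
  by rewrite {2}ecd -mulrA (mulrA y) -yd.
by rewrite ecd mulrA -yd.
Qed.

Section PrimitiveCorner.
Variable g : A.
Hypotheses (gg : g * g = g) (g0 : g != 0).
Hypothesis primg : forall e, e * e = e -> g * e = e -> e * g = e -> e = 0 \/ e = g.

Let corner x := g * x = x /\ x * g = x.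

Lemma cornerP a : corner (g * a * g).
Proof. by split; rewrite ?mulrA ?gg // -mulrA gg. Qed.

(** The projector of Fitting's lemma lies in g A g, so it is 0 or g. *)
Lemma corner_unit_or_nil x : corner x -> nilpotent x \/ exists c, c * x = g.
Proof.
move=> [gx xg]; have [k [c [d [e [k0 ee xe ec ed]]]]] := power_idempotent x.
case: k k0 xe ec ed => // k _ xe ec ed.
have [||e0|eg] := primg ee.
- by rewrite ed exprS !mulrA gx.
- by rewrite ec exprSr -!mulrA xg.
- by left; exists k.+1; rewrite -xe e0 mulr0.
- by right; exists (c * x ^+ k); rewrite -mulrA -exprSr -ec.
Qed.

Lemma corner_unit_nil x c : corner x -> c * x = g -> nilpotent x -> False.
Proof.
move=> [gx xg] cx [m xm]; move/eqP: g0; apply.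
suff : forall j, c ^+ j * x ^+ j * g = g by move/(_ m) <-; rewrite xm mulr0 mul0r.
elim=> [|j IHj]; first by rewrite !mul1r.
rewrite exprSr exprS mulrA -(mulrA _ c x) cx.
rewrite -!mulrA -[X in _ = X]IHj -mulrA; congr (_ * _).
by case: j {IHj} => [|j]; [rewrite !mul1r gg | rewrite exprS !mulrA gx].
Qed.

Lemma corner_nil_mull a x : corner x -> nilpotent x -> nilpotent (g * a * x).
Proof.
move=> cx nx; have [gx xg] := cx.
have [|//|[c cax]] := @corner_unit_or_nil (g * a * x).
  by split; rewrite ?mulrA ?gg // -mulrA xg.
by case: (corner_unit_nil (c := c * (g * a)) cx); rewrite // -mulrA.
Qed.

Lemma corner_nil_mulr a x : corner x -> nilpotent x -> nilpotent (x * a * g).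
Proof.
move=> cx nx; have [gx xg] := cx; have [m um] := corner_nil_mull a cx nx.
exists m.+1; set u := g * a * x in um.
have xug j : x * u ^+ j * g = x * u ^+ j.
  case: j => [|j]; first by rewrite mulr1.
  by rewrite exprSr /u -!mulrA xg.
suff xj j : (x * a * g) ^+ j * x = x * u ^+ j.
  by rewrite exprSr 2!mulrA xj um mulr0 !mul0r.
elim: j => [|j IHj]; first by rewrite mulr1 mul1r.
rewrite exprSr -[x * a * g]mulrA !mulrA IHj -xug exprSr /u.
by rewrite -!mulrA gx.
Qed.

(** If x + y were invertible, then g would be a sum u + v of nilpotent elements;
    but v acts as the identity on the nonzero kernel of u in A g. *)
Lemma corner_nilD x y :
  corner x -> corner y -> nilpotent x -> nilpotent y -> nilpotent (x + y).
Proof.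
move=> cx cy nx ny; have [gx xg] := cx; have [gy yg] := cy.
have [|//|[c cxy]] := @corner_unit_or_nil (x + y).
  by split; rewrite ?mulrDr ?mulrDl ?gx ?gy ?xg ?yg.
have [m um] := corner_nil_mull c cx nx; have [p vp] := corner_nil_mull c cy ny.
set u := g * c * x in um; set v := g * c * y in vp.
have uv : u + v = g by rewrite /u /v -mulrDr -mulrA cxy gg.
have gu : g * u = u by rewrite /u !mulrA gg.
have ex_m : exists m, u ^+ m * g == 0 by exists m; rewrite um mul0r.
case: (ex_minnP ex_m) => -[|j]; first by rewrite mul1r (negPf g0).
move=> /eqP uj minj; pose w := u ^+ j * g.
have w0 : w != 0 by apply/negP=> /minj; rewrite ltnn.
have gw : g * w = w.
  by rewrite /w; case: (j) => [|i]; rewrite ?mul1r // exprS 2!mulrA gu.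
have vw : v * w = w.
  have -> : v = g - u by rewrite -uv addrC addKr.
  by rewrite mulrBl gw {2}/w mulrA -exprS uj subr0.
suff : v ^+ p * w = w by rewrite vp mul0r => w00; rewrite -w00 eqxx in w0.
by elim: p {vp} => [|p IHp]; rewrite ?mul1r // exprSr -mulrA vw.
Qed.

Lemma corner_radical :
  exists N : {vspace A}, forall x, x \in N <-> corner x /\ nilpotent x.
Proof.
apply: vspace_of_submodule; split=> [|c x y [cx nx] [cy ny]].
  by rewrite /corner mulr0 mul0r; split=> //; exists 1%N; rewrite expr1.
have [gx xg] := cx; have [gy yg] := cy.
have cc : corner (c *: x) by split; rewrite -?scalerAr -?scalerAl ?gx ?xg.
have nc : nilpotent (c *: x) by have [m xm] := nx; exists m; rewrite exprZn xm scaler0.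
split; last exact: corner_nilD cc cy nc ny.
by have [gc cg] := cc; split; rewrite ?mulrDr ?mulrDl ?gc ?cg ?gy ?yg.
Qed.
End PrimitiveCorner.

(** For N nilpotent this follows by iterating the inclusion. Nilpotency of single
    elements is enough: if a left N-stable K <= N K + J not inside J has minimal
    dimension, then K = N x for some x in K, so x = y x with y nilpotent. *)
Lemma nil_nakayama N J :
  (forall x, x \in N -> nilpotent x) -> (N * N <= N)%VS -> (J * N <= J)%VS ->
  (N <= N * N + J)%VS -> (N <= J)%VS.
Proof.
move=> nilN NN JN NNJ.
suff sub_J : forall n K, (\dim K <= n)%N -> (K <= N)%VS -> (N * K <= K)%VS ->
    (K <= N * K + J)%VS -> (K <= J)%VS by exact: sub_J (leqnn _) (subvv N) NN NNJ.
elim=> [|n IHn] K dK KN NK KNJ.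
  by move: dK; rewrite leqn0 dimv_eq0 => /eqP->; rewrite sub0v.
apply: contrapT => KJ.
have [x Kx NxJ] : exists2 x, x \in K & ~ (N * <[x]> <= J)%VS.
  apply: contrapT => all_in; apply: KJ; apply: subv_trans KNJ _.
  rewrite subv_add subvv andbT; apply/prodvP => u v Nu Kv.
  apply: contrapT => uv; apply: all_in; exists v => // NvJ; apply: uv.
  by apply: (subvP NvJ); rewrite memv_mul ?memv_line.
have Nx_K : (N * <[x]> <= K)%VS.
  by apply: subv_trans NK; apply: prodvSr; rewrite -memvE.
have [eqK|neK] := eqVneq (\dim (N * <[x]>)) (\dim K).
  have : x \in (N * <[x]>)%VS.
    have /eqP-> // : (N * <[x]>)%VS == K.
    by rewrite eqEdim Nx_K eqK leqnn.
  rewrite -limg_amulr => /memv_imgP[y Ny]; rewrite lfunE /= => xyx.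
  have [m ym] := nilN _ Ny; apply: NxJ.
  have -> : x = 0.
    suff -> : x = y ^+ m * x by rewrite ym mul0r.
    by elim: m {ym} => [|m IHm]; rewrite ?mul1r // exprSr -mulrA -xyx.
  by apply/prodvP=> u v _ /vlineP[c ->]; rewrite scaler0 mulr0 mem0v.
apply: NxJ; apply: IHn.
- by rewrite -ltnS (leq_trans _ dK) // ltn_neqAle neK dimvS.
- exact: subv_trans Nx_K KN.
- by rewrite prodvA; apply: prodvSl.
apply: (subv_trans (prodvSl <[x]> NNJ)).
rewrite prodvDl prodvA subv_add addvSl /=.
apply: subv_trans (addvSr _ _); apply: subv_trans JN; apply: prodvSr.
by rewrite -memvE (subvP KN).
Qed.
End Idempotents.

(** * Generation by idempotents *)

Section Generation.
Variables (F : fieldType) (A : falgType F).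
Implicit Types (a x y g e : A) (I J N P Q E : {vspace A}).

Definition residues_split : Prop :=
  forall P, two_sided_ideal P -> 1 \notin P ->
    (forall x, x \notin P -> exists y, y * x - 1 \in P) ->
    forall x, exists c : F, x - c%:A \in P.

(** P is the annihilator of the one-dimensional module A / P, whose
    self-extensions are classified by the dual of P / P^2. The inclusion of P in
    every such Q is asked only for elements of the radical, which suffices to
    detect a self-extension and is what the heredity condition J N J = 0 gives. *)
Definition no_self_extensions : Prop :=
  forall P Q, two_sided_ideal P -> two_sided_ideal Q -> 1 \notin P ->
    (forall x, exists c : F, x - c%:A \in P) -> (P * P <= Q)%VS ->
    forall a, a \in P -> in_jacobson_radical a -> a \in Q.

Lemma left_idealP I a x : left_ideal I -> x \in I -> a * x \in I.
Proof. by move=> /prodvP I_l Ix; apply: I_l; rewrite ?memvf. Qed.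

Lemma two_sided_idealP J a x :
  two_sided_ideal J -> x \in J -> a * x \in J /\ x * a \in J.
Proof.
by case/andP=> /prodvP Jl /prodvP Jr Jx; split; [apply: Jl|apply: Jr]; rewrite ?memvf.
Qed.

(** A maximal left ideal I not containing a gives 1 = i + b a, so 1 is congruent
    to all powers of the nilpotent element b a modulo I. *)
Lemma nil_left_ideal_jacobson a :
  (forall b, nilpotent (b * a)) -> in_jacobson_radical a.
Proof.
move=> nil_a I [I_l In Imax].
pose I' := (I + amulr a @: fullv)%VS.
have I'_l : left_ideal I'.
  apply/prodvP=> b _ _ /memv_addP[x Ix [_ /memv_imgP[y _ ->] ->]].
  rewrite lfunE /= mulrDr; apply: memv_add; first exact: left_idealP.
  by apply/memv_imgP; exists (b * y); rewrite ?memvf // lfunE /= mulrA.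
case: (Imax I' I'_l (addvSl _ _)) => I'E.
  rewrite -I'E; apply: (subvP (addvSr _ _)); apply/memv_imgP; exists 1.
    exact: memvf.
  by rewrite lfunE /= mul1r.
have : 1 \in I' by rewrite I'E memvf.
move=> /memv_addP[i Ii [_ /memv_imgP[b _ ->]]]; rewrite lfunE /= => /eqP.
rewrite -subr_eq => /eqP i1; rewrite -i1 in Ii.
have Ij j : 1 - (b * a) ^+ j \in I.
  elim: j => [|j IHj]; first by rewrite subrr mem0v.
  have -> : 1 - (b * a) ^+ j.+1 = 1 - (b * a) ^+ j + (b * a) ^+ j * (1 - b * a).
    by rewrite mulrBr mulr1 -exprSr addrA subrK.
  by rewrite memvD // left_idealP.
have [m bam] := nil_a b; case/eqP: In; apply/eqP; rewrite eqEsubv subvf.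
apply/subvP=> x _; rewrite -[x]mulr1; apply: left_idealP => //.
by have := Ij m; rewrite bam subr0.
Qed.

Section SubalgebraOfIdempotents.
Variable E : {vspace A}.
Hypothesis (EM : (E * E <= E)%VS).
Hypothesis (idemE : forall e, e * e = e -> e \in E).
Hypotheses (splitA : residues_split) (no_loop : no_self_extensions).

Lemma idem_compl e : e * e = e -> (1 - e) * (1 - e) = 1 - e.
Proof. by move=> ee; rewrite mulrBl mul1r mulrBr mulr1 ee subrr subr0. Qed.

Lemma idem_mul_compl e : e * e = e -> e * (1 - e) = 0 /\ (1 - e) * e = 0.
Proof. by move=> ee; rewrite mulrBr mulrBl mulr1 mul1r ee subrr. Qed.

(** e + e a (1 - e) is idempotent. *)
Lemma peirce_offdiag e a : e * e = e -> e * a * (1 - e) \in E.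
Proof.
move=> ee; have [ef fe] := idem_mul_compl ee.
set x := e * a * (1 - e).
have ex : e * x = x by rewrite /x !mulrA ee.
have xe : x * e = 0 by rewrite /x -mulrA fe mulr0.
have xx : x * x = 0 by rewrite -{2}ex mulrA xe mul0r.
have Ex : e + x \in E.
  by apply: idemE; rewrite mulrDl !mulrDr ee ex xe xx !addr0.
by rewrite -(addKr e x) memvD // memvN; exact: idemE.
Qed.

(** Here C = g A g is the corner, N its radical and J = X Y = g A (1 - g) A g.
    The compression L : x |-> g x g is multiplicative modulo J, which makes
    the preimages of N and of T = N^2 + J two-sided ideals of A. *)
Lemma primitive_corner_mem g :
  g * g = g -> g != 0 ->
  (forall e, e * e = e -> g * e = e -> e * g = e -> e = 0 \/ e = g) ->
  forall a, g * a * g \in E.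
Proof.
move=> gg g0 primg.
have [ghK hgK] := idem_mul_compl gg; have hh := idem_compl gg.
have [N NE] := corner_radical gg g0 primg.
pose L : 'End(A) := (amull g \o amulr g)%VF.
have LE x : L x = g * x * g by rewrite !lfunE /= !lfunE /= mulrA.
pose C := limg L.
have CE x : x \in C -> g * x = x /\ x * g = x.
  by move=> /memv_imgP[y _ ->]; rewrite LE; exact: cornerP.
have LC x : g * x * g \in C by rewrite -LE memv_img ?memvf.
have CI x : g * x = x -> x * g = x -> x \in C by move=> gx xg; rewrite -xg -gx LC.
have CC : (C * C <= C)%VS.
  apply/prodvP=> x y /CE[gx _] /CE[_ yg]; apply: CI.
    by rewrite mulrA gx.
  by rewrite -mulrA yg.
have NC : (N <= C)%VS by apply/subvP=> x /NE[[gx xg] _]; apply: CI.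
have nilN x : x \in N -> nilpotent x by case/NE.
have CN : (C * N <= N)%VS.
  apply/prodvP=> x y /CE[gx xg] /NE[cy ny]; apply/NE.
  have -> : x * y = g * x * y by rewrite gx.
  have [gy yg] := cy; split; last exact: (corner_nil_mull gg g0 primg x cy ny).
  by split; rewrite ?mulrA ?gg // -mulrA yg.
have N_C : (N * C <= N)%VS.
  apply/prodvP=> x y /NE[cx nx] /CE[gy yg]; apply/NE.
  have -> : x * y = x * y * g by rewrite -mulrA yg.
  have [gx xg] := cx; split; last exact: (corner_nil_mulr gg g0 primg y cx nx).
  by split; rewrite ?mulrA ?gx // -mulrA gg.
have NN : (N * N <= N)%VS by apply: subv_trans N_C; apply: prodvSr.
pose X := limg (amull g \o amulr (1 - g))%VF.
pose Y := limg (amull (1 - g) \o amulr g)%VF.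
have XI a : g * a * (1 - g) \in X.
  by apply/memv_imgP; exists a; rewrite ?memvf // !lfunE /= !lfunE /= mulrA.
have YI a : (1 - g) * a * g \in Y.
  by apply/memv_imgP; exists a; rewrite ?memvf // !lfunE /= !lfunE /= mulrA.
have XE x : x \in X -> exists a, x = g * a * (1 - g).
  by move=> /memv_imgP[a _ ->]; exists a; rewrite !lfunE /= !lfunE /= mulrA.
have YE y : y \in Y -> exists a, y = (1 - g) * a * g.
  by move=> /memv_imgP[a _ ->]; exists a; rewrite !lfunE /= !lfunE /= mulrA.
pose J := (X * Y)%VS.
have JC : (J <= C)%VS.
  apply/prodvP=> _ _ /XE[a ->] /YE[b ->]; apply: CI.
    by rewrite !mulrA gg.
  by rewrite -!mulrA gg.
have CJ : (C * J <= J)%VS.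
  rewrite /J prodvA; apply: prodvSl; apply/prodvP=> x _ /CE[gx xg] /XE[a ->].
  have -> : x * (g * a * (1 - g)) = g * (x * a) * (1 - g); last exact: XI.
  by rewrite !mulrA xg gx.
have J_C : (J * C <= J)%VS.
  rewrite /J -prodvA; apply: prodvSr; apply/prodvP=> _ x /YE[a ->] /CE[gx xg].
  have -> : (1 - g) * a * g * x = (1 - g) * (a * x) * g; last exact: YI.
  by rewrite -!mulrA gx xg.
have JE : (J <= E)%VS.
  apply: subv_trans EM; apply: prodvS; apply/subvP.
    by move=> _ /XE[a ->]; apply: peirce_offdiag.
  move=> _ /YE[a ->]; have := peirce_offdiag a hh; congr (_ * _ \in E).
  by rewrite opprB addrC subrK.
(* An element of J outside N is invertible in C, so J = C. *)
have [JN|] := boolP (J <= N)%VS; last first.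
  case/subvPn => j Jj Nj a; have [gj jg] := CE _ (subvP JC _ Jj).
  have [nj|[c cj]] := corner_unit_or_nil primg (conj gj jg).
    by case/negP: Nj; apply/NE.
  have gJ : g \in J.
    have -> : g = (g * c * g) * j by rewrite -mulrA gj -mulrA cj gg.
    exact: (subvP CJ _ (memv_mul (LC c) Jj)).
  have -> : g * a * g = g * (g * a * g) by rewrite !mulrA gg.
  exact: (subvP JE _ (subvP J_C _ (memv_mul gJ (LC a)))).
pose T := (N * N + J)%VS.
have TN : (T <= N)%VS by rewrite subv_add NN.
have CT : (C * T <= T)%VS.
  rewrite /T prodvDr subv_add; apply/andP; split; last exact: subv_trans CJ (addvSr _ _).
  by rewrite prodvA; apply: subv_trans (addvSl _ _); apply: prodvSl.
have T_C : (T * C <= T)%VS.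
  rewrite /T prodvDl subv_add; apply/andP; split; last exact: subv_trans J_C (addvSr _ _).
  by rewrite -prodvA; apply: subv_trans (addvSl _ _); apply: prodvSr.
have Lmul x y : L (x * y) = L x * L y + g * x * (1 - g) * ((1 - g) * y * g).
  rewrite !LE !mulrA -(mulrA _ g g) gg -(mulrA _ (1 - g) (1 - g)) hh -!mulrDl.
  by rewrite -mulrDr addrC subrK mulr1.
have crossJ x y : g * x * (1 - g) * ((1 - g) * y * g) \in J by rewrite memv_mul.
have ideal_preim U : (C * U <= U)%VS -> (U * C <= U)%VS -> (J <= U)%VS ->
    two_sided_ideal (L @^-1: U)%VS.
  move=> CU U_C JU; apply/andP; split; apply/prodvP=> x y.
    rewrite -!memv_preim Lmul => _ Uy; apply: memvD; last exact: (subvP JU).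
    exact: (subvP CU _ (memv_mul (memv_img L (memvf x)) Uy)).
  rewrite -!memv_preim Lmul => Ux _; apply: memvD; last exact: (subvP JU).
  exact: (subvP U_C _ (memv_mul Ux (memv_img L (memvf y)))).
have idP := ideal_preim _ CN N_C JN.
have idQ := ideal_preim _ CT T_C (addvSr _ _).
have P1 : 1 \notin (L @^-1: N)%VS.
  apply/negP; rewrite -memv_preim LE mulr1 gg => /NE[cg ng].
  exact: (corner_unit_nil gg g0 cg gg ng).
have divP x : x \notin (L @^-1: N)%VS -> exists y, y * x - 1 \in (L @^-1: N)%VS.
  rewrite -memv_preim LE => Nx.
  have [nx|[c cx]] := corner_unit_or_nil primg (cornerP gg x).
    by case/negP: Nx; apply/NE; split=> //; apply: cornerP.
  exists (c * g); rewrite -memv_preim linearB /= !LE mulr1 gg.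
  rewrite !mulrA -(mulrA g c) in cx *; rewrite -!mulrA in cx *.
  by rewrite cx gg subrr mem0v.
have splitP := splitA idP P1 divP.
have PPQ : (L @^-1: N * L @^-1: N <= L @^-1: T)%VS.
  apply/prodvP=> x y; rewrite -!memv_preim => Nx Ny.
  by rewrite Lmul memv_add ?memv_mul.
have NT : (N <= T)%VS.
  apply/subvP=> a Na; have [ca na] := iffLR (NE a) Na.
  have La : L a = a by rewrite LE; case: ca => -> ->.
  rewrite -La memv_preim; apply: no_loop splitP PPQ _ _ _ => //.
    by rewrite -memv_preim La.
  apply: nil_left_ideal_jacobson => b; have [m um] := corner_nil_mull gg g0 primg b ca na.
  exists m.+1; have [ga ag] := ca.
  suff aj j : a * (b * a) ^+ j = a * (g * b * a) ^+ j.
    by rewrite exprS -mulrA aj um !mulr0.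
  elim: j => [//|j IHj]; rewrite !exprS -(mulrA b) IHj !mulrA.
  by rewrite ag.
have NJ := nil_nakayama nilN NN (subv_trans (prodvSr _ NC) J_C) NT.
move=> a; have [c] := splitP a; rewrite -memv_preim linearB /= !LE => Nac.
rewrite -[g * a * g](subrK (g * c%:A * g)) memvD //.
  by apply: (subvP JE); apply: (subvP NJ).
by rewrite -scalerAr mulr1 -scalerAl gg memvZ // idemE.
Qed.

Lemma corner_dim_lt e f :
  e * e = e -> f * e = e -> e * f = e -> e != f ->
  (\dim (limg (amull e)) < \dim (limg (amull f)))%N.
Proof.
move=> ee fe ef; apply: contraNT; rewrite -leqNgt => dim_fe.
have sub_ef : (limg (amull e) <= limg (amull f))%VS.
  apply/subvP=> _ /memv_imgP[x _ ->]; rewrite lfunE /= -fe -mulrA.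
  by apply/memv_imgP; exists (e * x); rewrite ?memvf // lfunE.
have : f \in limg (amull e).
  have /eqP-> : limg (amull e) == limg (amull f) by rewrite eqEdim sub_ef.
  by apply/memv_imgP; exists 1; rewrite ?memvf // lfunE /= mulr1.
by move=> /memv_imgP[x _]; rewrite lfunE /= => fx; rewrite -[e in e == _]ef fx mulrA ee.
Qed.

(** Induction on the dimension of f A. If f is the sum of orthogonal idempotents
    e and e', the corners of e and e' are in E by induction, and the mixed terms
    by [peirce_offdiag]. *)
Lemma corner_mem f a : f * f = f -> f * a * f \in E.
Proof.
have [n] := ubnP (\dim (limg (amull f))).
elim: n f a => // n IHn f a; rewrite ltnS => dimf ff.
have [->|f0] := eqVneq f 0; first by rewrite mulr0 mem0v.
have [primf|] := pselect
  (forall e, e * e = e -> f * e = e -> e * f = e -> e = 0 \/ e = f).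
  exact: primitive_corner_mem.
move=> /existsNP[e /not_implyP[ee /not_implyP[fe /not_implyP[ef]]]].
move=> /not_orP[/eqP e0 /eqP ef'].
pose e' := f - e.
have e'e : e' * e = 0 by rewrite mulrBl fe ee subrr.
have ee' : e * e' = 0 by rewrite mulrBr ef ee subrr.
have e'e' : e' * e' = e' by rewrite {1}/e' mulrBl ee' subr0 mulrBr ff fe.
have fe' : f * e' = e' by rewrite mulrBr ff fe.
have e'f : e' * f = e' by rewrite mulrBl ff ef.
have eE : f = e + e' by rewrite addrC subrK.
have dim_e : (\dim (limg (amull e)) < n)%N.
  by apply: leq_trans dimf; apply: corner_dim_lt.
have dim_e' : (\dim (limg (amull e')) < n)%N.
  apply: leq_trans dimf; apply: corner_dim_lt => //.
  by rewrite -subr_eq0 /e' addrAC subrr add0r oppr_eq0.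
have offdiag p q b : p * p = p -> q * p = 0 -> p * b * q \in E.
  move=> pp qp; have -> : p * b * q = p * (b * q) * (1 - p).
    by rewrite mulrBr mulr1 -!mulrA qp !mulr0 subr0.
  exact: peirce_offdiag.
have -> : f * a * f = e * a * e + e * a * e' + (e' * a * e + e' * a * e').
  by rewrite -!mulrDr -!mulrDl -eE.
by rewrite !memvD ?IHn ?offdiag.
Qed.

Theorem idempotents_generate : E = fullv.
Proof.
apply/eqP; rewrite eqEsubv subvf; apply/subvP=> a _.
by have := corner_mem a (mulr1 1); rewrite mul1r mulr1.
Qed.
End SubalgebraOfIdempotents.
End Generation.

(** * Zero products and idempotents *)

Section ZeroProducts.
Variables (F : fieldType) (A : falgType F).

Theorem zero_product_determined_of_idempotents :
  (forall E : {vspace A}, (E * E <= E)%VS ->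
     (forall e : A, e * e = e -> e \in E) -> E = fullv) ->
  zero_product_determined A.
Proof.
move=> genA f f0.
have [|E EP] := @vspace_of_submodule _ A
    (fun r => forall x y, f (x * r) y = f x (r * y)).
  split=> [x y|c r s fr fs x y]; first by rewrite mulr0 mul0r linear0l linear0r.
  rewrite mulrDr mulrDl linearDl linearDr -scalerAr -scalerAl.
  by rewrite linearZl_LR linearZr_LR /= fr fs.
have EE : (E * E <= E)%VS.
  apply/prodvP=> r s /EP fr /EP fs; apply/EP => x y.
  by rewrite mulrA fs fr mulrA.
have idemE e : e * e = e -> e \in E.
  move=> ee; apply/EP=> x y.
  have e_left : f (x * e) ((1 - e) * y) = 0.
    by apply: f0; rewrite mulrA -(mulrA x) mulrBr mulr1 ee subrr mulr0 mul0r.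
  have e_right : f (x * (1 - e)) (e * y) = 0.
    by apply: f0; rewrite mulrA -(mulrA x) mulrBl mul1r ee subrr mulr0 mul0r.
  move: e_left e_right; rewrite mulrBl mulrBr mul1r mulr1 linearBl linearBr.
  by move=> /eqP; rewrite subr_eq0 => /eqP-> /eqP; rewrite subr_eq0 => /eqP->.
exists (applyr f 1) => x y; have /EP fy : y \in E by rewrite (genA _ EE idemE) memvf.
by rewrite /= fy mulr1.
Qed.
End ZeroProducts.

(** * Self-extensions in finite global dimension *)

Section SelfExtensions.
Variables (F : fieldType) (A : falgType F).
Implicit Types (I J P Q : {vspace A}).

Lemma codim1_commutator P Q :
  two_sided_ideal P -> (forall x, exists c : F, x - c%:A \in P) ->
  (P * P <= Q)%VS -> forall x y : A, x * y - y * x \in Q.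
Proof.
move=> idP splitP PPQ x y; have [c xc] := splitP x; have [d yd] := splitP y.
have commB (u v : A) (a : F) : (u - a%:A) * v - v * (u - a%:A) = u * v - v * u.
  by rewrite mulrBl mulrBr mulr_algl mulr_algr opprB addrA subrK.
rewrite -(commB x y c) -opprB -(commB y _ d) opprB.
by apply: memvB; apply: (subvP PPQ); apply: memv_mul.
Qed.

Lemma gldim_no_self_extensions :
  finite_global_dimension A -> no_self_extensions A.
Proof.
move=> gldim P Q idP idQ P1 splitP PPQ a Pa _.
(* The Fitting idempotent e of a lies in P, hence in P^2 <= Q, and a (1 - e) is *)
(* the nilpotent part of a. *)
have [k [c [d [e [k0 ee ae ec ed]]]]] := power_idempotent a.
have Qe : e \in Q.
  rewrite -ee; apply: (subvP PPQ); apply: memv_mul; rewrite ec -(prednK k0) exprS;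
    by apply: (two_sided_idealP _ idP _).1; apply: (two_sided_idealP _ idP _).2.
apply: contrapT => /negP Qa; pose b := a * (1 - e).
have Qb : b \notin Q.
  apply: contraNN Qa => Qb; rewrite -[a](subrK (a * e)) memvD //.
    by move: Qb; rewrite /b mulrBr mulr1.
  exact: (two_sided_idealP a idQ Qe).1.
have ea0 : e * b = 0.
  by rewrite ec /b -mulrA (mulrA (a ^+ k)) -exprSr exprS -mulrA mulrBr mulr1 ae subrr !mulr0.
have bk : b ^+ k = 0.
  case: (k) k0 ae => // j _ ae.
  suff -> : b ^+ j.+1 = a ^+ j.+1 * (1 - e) by rewrite mulrBr mulr1 ae subrr.
  elim: j {ae} => [|j IHj]; first by rewrite !expr1.
  by rewrite exprSr IHj -mulrA mulrBl mul1r ea0 subr0 /b mulrA -exprSr.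
have [t [tb tQ]] := separating_functional Qb.
have tC x y : t (x * y) = t (y * x).
  apply/eqP; rewrite -subr_eq0 -linearB; apply/eqP; apply: tQ.
  exact: codim1_commutator idP splitP PPQ x y.
have tb0 : t b = 0 := nilpotent_trace_eq0 (@falg_noetherian F A) gldim tC bk.
by move/eqP: tb; rewrite tb0 eq_sym oner_eq0.
Qed.
End SelfExtensions.

(** * Self-extensions of quasi-hereditary algebras *)

Section QuasiHereditary.
Variables (F : fieldType) (A : falgType F).
Implicit Types (I J P Q : {vspace A}).

(** The preimage of a maximal left ideal is a maximal left ideal. *)
Lemma jacobson_quotient (B : falgType F) (pi : {lrmorphism A -> B}) a :
  (forall b, exists x, pi x = b) -> in_jacobson_radical a ->
  in_jacobson_radical (pi a).
Proof.
move=> surj rad_a I [I_l In Imax].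
have memI x : (x \in linfun pi @^-1: I)%VS = (pi x \in I).
  by rewrite -memv_preim lfunE.
rewrite -memI; apply: rad_a; split.
- by apply/prodvP=> x y _; rewrite !memI rmorphM; apply: left_idealP.
- apply: contraNneq In => preimT; rewrite eqEsubv subvf; apply/subvP => b _.
  by have [x <-] := surj b; rewrite -memI preimT memvf.
move=> K K_l IK; have kerK x y : pi x = pi y -> y \in K -> x \in K.
  move=> xy Ky; rewrite -[x](subrK y) memvD //; apply: (subvP IK).
  by rewrite memI rmorphB /= xy subrr mem0v.
have memK x : x \in K -> pi x \in (linfun pi @: K)%VS.
  by move=> Kx; rewrite -[pi x](lfunE pi) memv_img.
have KE : forall x, pi x \in (linfun pi @: K)%VS -> x \in K.
  by move=> x /memv_imgP[y Ky]; rewrite lfunE => xy; apply: kerK Ky.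
have [||eqK|eqK] := Imax (linfun pi @: K)%VS.
- apply/prodvP=> b _ _ /memv_imgP[y Ky ->]; have [x <-] := surj b.
  by rewrite lfunE /= -rmorphM memK // left_idealP.
- apply/subvP => b; have [x <-] := surj b; rewrite -memI => Ix.
  by rewrite memK // (subvP IK).
- left; apply/eqP; rewrite eqEsubv IK andbT; apply/subvP=> x Kx.
  by rewrite memI -eqK memK.
- right; apply/eqP; rewrite eqEsubv subvf; apply/subvP => x _.
  by apply: KE; rewrite eqK memvf.
Qed.

(** The layer J_(i+1) is not inside P: being idempotent modulo J_i <= Q, it would
    be inside P^2 + Q. So it contains some e congruent to 1 modulo P, and
    e a e lies in J_i for a in the radical. For a in P, e a e is congruent to a
    modulo P^2. *)
Lemma quasi_hereditary_no_self_extensions :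
  quasi_hereditary A -> no_self_extensions A.
Proof.
move=> [n [J [J0 Jn idJ _ hered]]] P Q idP idQ P1 splitP PPQ a Pa rad_a.
apply: contrapT => Qa.
have ex_m : exists m, ~~ (J m <= Q)%VS.
  by exists n; rewrite Jn; apply/negP => /subvP/(_ a (memvf a)).
case: (ex_minnP ex_m) => -[|i]; first by rewrite J0 sub0v.
move=> JQ min_i.
have i_n : (i < n)%N.
  by apply: min_i; rewrite Jn; apply/negP => /subvP/(_ a (memvf a)).
have JiQ : (J i <= Q)%VS by apply: contraT => /min_i; rewrite ltnn.
have [|B [pi [[surj kerpi] [idH HH HNH _]]]] := hered i i_n.
  apply: contraNneq JQ => JiT; apply: subv_trans JiQ; rewrite JiT subvf //.
have memPi (U : {vspace A}) x : x \in U -> pi x \in (linfun pi @: U)%VS.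
  by move=> Ux; rewrite -[pi x](lfunE pi) memv_img.
have QJ x y : pi x = pi y -> y \in Q -> x \in Q.
  move=> xy Qy; rewrite -[x](subrK y) memvD //; apply: (subvP JiQ).
  by apply/kerpi; rewrite rmorphB /= xy subrr.
have JP : ~~ (J i.+1 <= P)%VS.
  apply: contraNN JQ => JP; apply/subvP => x /memPi.
  have HP : (linfun pi @: J i.+1 * linfun pi @: J i.+1 <= linfun pi @: (P * P))%VS.
    apply/prodvP => _ _ /memv_imgP[y Jy ->] /memv_imgP[z Jz ->].
    rewrite !lfunE /= -rmorphM; apply: memPi.
    by rewrite memv_mul ?(subvP JP).
  rewrite -HH => /(subvP HP)/memv_imgP[y PPy]; rewrite lfunE => xy.
  exact: QJ xy (subvP PPQ _ PPy).
have [u Ju Pu] := subvPn JP; have [c uc] := splitP u.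
have c0 : c != 0 by apply: contraNneq Pu => c0; rewrite c0 scale0r subr0 in uc.
pose e := c^-1 *: u; pose p := 1 - e.
have Pp : p \in P.
  have -> : p = - (c^-1 *: (u - c%:A)).
    by rewrite scalerBr scalerA mulVf // scale1r opprB.
  by rewrite memvN memvZ.
have Je : e \in J i.+1 by rewrite memvZ.
have /kerpi Jeae : pi (e * a * e) = 0.
  by rewrite !rmorphM HNH ?memPi //; apply: jacobson_quotient.
have Qpp x y : x \in P -> y \in P -> x * y \in Q.
  by move=> Px Py; apply: (subvP PPQ); apply: memv_mul.
apply: Qa; have -> : a = e * a * e + (p * a + a * p - p * a * p).
  have -> : e = 1 - p by rewrite opprB addrC subrK.
  clearbody p; rewrite (mulrBl a) mul1r mulrBr mulr1 mulrBl -(addrA (p * a)).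
  by rewrite -(addrA a) -opprD subrK.
apply: memvD; first exact: (subvP JiQ).
apply: memvB; first by apply: memvD; apply: Qpp.
apply: Qpp => //; exact: (two_sided_idealP a idP Pp).2.
Qed.
End QuasiHereditary.

(** * Residue fields of cellular algebras *)

Section Cellular.
Variables (F : fieldType) (A : falgType F).

Lemma free_notin_span (T : finType) (c : T -> A) u (D : {pred T}) :
  free [seq c v | v] -> u \notin D -> c u \notin <<[seq c v | v in D]>>%VS.
Proof.
move=> freec uD.
have /perm_free eqf : perm_eq [seq c v | v] (c u :: [seq c v | v in predC1 u]).
  rewrite -[_ :: _]/(map c (u :: enum (predC1 u))); apply: perm_map.
  apply: uniq_perm; rewrite ?enum_uniq //=.
    by rewrite enum_uniq andbT mem_enum !inE eqxx.
  by move=> v; rewrite inE !mem_enum !inE orbN.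
move: freec; rewrite eqf free_cons => /andP[/negP cu _].
apply/negP => cuD; apply: cu; apply: subvP cuD; apply: sub_span => w.
move=> /imageP[v vD ->]; apply: image_f; rewrite inE.
by apply: contraNneq uD => <-.
Qed.

(** For C = C_st, the element C a C = (C a) C is a combination of the C_s't modulo
    lower cells, and also, applying the anti-involution, of the C_st'; so it is a
    multiple of C. If y C = 1 modulo P, multiplying C (x y) C = c C by y gives
    x = c modulo P. *)
Lemma cellular_residues_split : cellular A -> residues_split A.
Proof.
move=> [disp [L [M [C [star [r [basisC [starM starK] starC cellC]]]]]]].
pose cell (u : {l : L & (M l * M l)%type}) := C (tag u) (tagged u).1 (tagged u).2.
pose A_lt (l : L) := <<[seq cell u | u in [pred u | (tag u < l)%O]]>>%VS.
move=> P idP P1 divP.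
have [l [s [t [CP lowP]]]] : exists (l : L) s t, C l s t \notin P /\
    (A_lt l <= P)%VS.
  have ex_d : exists d : nat, `[< exists (l : L) s t,
      C l s t \notin P /\ d = #|[pred m | (m < l)%O]| >].
    apply: contrapT => none; case/negP: P1.
    have : 1 \in <<[seq cell u | u]>>%VS by case/andP: basisC => /eqP-> _; rewrite memvf.
    apply: subvP; apply/span_subvP => _ /imageP[[l [s t]] _ ->].
    apply: contraT => /= Cl; case: none; exists #|[pred m | (m < l)%O]|.
    by apply/asboolP; exists l, s, t.
  case: (ex_minnP ex_d) => d /asboolP[l [s [t [CP ->]]]] min_d.
  exists l, s, t; split=> //; apply/span_subvP => _ /imageP[[m [s' t']] /= ml ->].
  rewrite inE /= in ml; apply: contraT => /= Cm.
  have := min_d #|[pred k | (k < m)%O]|.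
  rewrite leqNgt => /(_ _)/negP; case; first by apply/asboolP; exists m, s', t'.
  apply: proper_card; apply/properP; split.
    by apply/subsetP => k; rewrite !inE => /Order.POrderTheory.lt_trans; apply.
  by exists m; rewrite !inE // Order.POrderTheory.ltxx.
pose idx (s' t' : M l) : {m : L & (M m * M m)%type} :=
  Tagged (fun m : L => (M m * M m)%type) (s', t').
have starA_lt x : x \in A_lt l -> star x \in A_lt l.
  move=> Ax; have : star x \in (linfun star @: A_lt l)%VS.
    by rewrite -[star x](lfunE star) memv_img.
  apply: subvP; rewrite limg_span; apply/span_subvP => x' /mapP[w].
  move=> /imageP[[m [s' t']] ml ->] ->.
  rewrite lfunE /= /cell /= starC; apply: memv_span.
  by apply/imageP; exists (Tagged (fun l : L => (M l * M l)%type) (t', s')).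
have scalarC a : exists c : F, C l s t * a * C l s t - c *: C l s t \in A_lt l.
  set z := _ * a * _.
  have row_z := cellC (C l s t * a) l s t; rewrite -/z in row_z.
  have := starA_lt _ (cellC (C l t s * star a) l t s).
  have -> : C l t s * star a * C l t s = star z by rewrite /z !starM !starC mulrA.
  rewrite linearB /= starK linear_sum.
  under eq_bigr => t' _ do rewrite linearZ /= starC.
  move=> col_z; set r1 := r l _ in row_z; set r2 := r l _ in col_z.
  exists (r1 s s).
  have r1_0 s' : s' != s -> r1 s' s = 0.
    move=> s's; pose S := <<[seq cell v | v in predC1 (idx s' t)]>>%VS.
    have CS s2 t2 : (s2, t2) != (s', t) -> C l s2 t2 \in S.
      move=> ne; apply: memv_span; apply/imageP; exists (idx s2 t2) => //.
      rewrite inE; apply: contraNneq ne; rewrite /idx => /eqP.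
      by rewrite eq_Tagged /= => /eqP[-> ->].
    have AS : (A_lt l <= S)%VS.
      apply: sub_span => _ /imageP[v vl ->]; apply: image_f; rewrite inE.
      by apply: contraTneq vl => ->; rewrite inE /= Order.POrderTheory.ltxx.
    have : r1 s' s *: C l s' t \in S.
      have -> : r1 s' s *: C l s' t = (z - \sum_t' r2 t' t *: C l s t') -
          (z - \sum_s' r1 s' s *: C l s' t) + \sum_t' r2 t' t *: C l s t' -
          \sum_(s2 | s2 != s') r1 s2 s *: C l s2 t.
        rewrite [X in _ = X - _]addrAC subrK subKr [in RHS](bigD1 s') //=.
        by rewrite addrK.
      apply: memvB; first apply: memvD; first apply: memvB.
      - exact: (subvP AS).
      - exact: (subvP AS).
      - apply: memv_suml => i _; rewrite memvZ // CS // xpair_eqE eq_sym.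
        by rewrite (negPf s's).
      - by apply: memv_suml => i i_ne; rewrite memvZ // CS // xpair_eqE (negPf i_ne).
    have [->//|r0] := eqVneq (r1 s' s) 0.
    rewrite rpredZeq (negPf r0) /=.
    have [_ freeC] := andP basisC.
    have /negPf : cell (idx s' t) \notin S by apply: free_notin_span; rewrite ?inE ?eqxx.
    by rewrite /cell /= => ->.
  rewrite (bigD1 s) //= big1 ?addr0 // in row_z.
  by move=> s' s's; rewrite r1_0 ?scale0r.
have [y yC] := divP _ CP.
move=> x; have [c zc] := scalarC (x * y); exists c.
have mulP b w : w \in P -> b * w \in P by move=> Pw; case: (two_sided_idealP b idP Pw).
have Pmul b w : w \in P -> w * b \in P by move=> Pw; case: (two_sided_idealP b idP Pw).
pose k := C l s t; rewrite -/k in zc yC.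
have -> : x - c%:A = y * (k * (x * y) * k - c *: k) + c *: (y * k - 1)
    - (y * k - 1) * (x * y * k) - x * (y * k - 1).
  rewrite !mulrBr !mulrBl !mul1r !mulr1 scalerBr -scalerAr !mulrA.
  rewrite addrA subrK !opprB [X in _ = X + _]addrC addrA subrK.
  by rewrite [RHS]addrC addrA subrK.
apply: memvB; [apply: memvB; [apply: memvD|]|]; last exact: mulP.
- exact: mulP (subvP lowP _ zc).
- exact: memvZ.
- exact: Pmul.
Qed.
End Cellular.

(** * Quotients of the regular module *)

Section QuotientModule.
Variables (F : fieldType) (A : falgType F) (P : {vspace A}).
Hypothesis idP : left_ideal P.

(** The quotient A / P is realised on a complement of P, with pr the projection
    along P. *)
Let pr (x : A) : subvs_of P^C := vsproj P^C (daddv_pi P^C P x).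

Let prB x y : pr (x - y) = pr x - pr y.
Proof. by rewrite /pr !linearB. Qed.

Let prK v : pr (vsval v) = v.
Proof. by rewrite /pr daddv_pi_id ?subvsP ?vsvalK // capvC capv_compl. Qed.

Let pr0 x : x \in P -> pr x = 0.
Proof.
move=> Px; have cap0 : (P :&: P^C = 0)%VS by rewrite capv_compl.
have := daddv_pi_add cap0 (w := x); rewrite addv_complf memvf => /(_ isT).
by rewrite (daddv_pi_id cap0 Px) -[RHS]addr0 /pr => /addrI->; rewrite linear0.
Qed.

Let pr_eq x y : x - y \in P -> pr x = pr y.
Proof. by move=> /pr0; rewrite prB => /eqP; rewrite subr_eq0 => /eqP. Qed.

Let pr_ker x : pr x = 0 -> x \in P.
Proof.
move=> prx; have cap0 : (P :&: P^C = 0)%VS by rewrite capv_compl.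
have := daddv_pi_add cap0 (w := x); rewrite addv_complf memvf => /(_ isT) <-.
have -> : daddv_pi P^C P x = 0.
  by rewrite -[LHS](vsprojK (memv_pi _ _ _)) -/(pr x) prx linear0.
by rewrite addr0 memv_pi.
Qed.

Let prS x : x - vsval (pr x) \in P.
Proof. by apply: pr_ker; rewrite prB prK subrr. Qed.

Definition quotient_mod (_ : left_ideal P) : Type := subvs_of P^C.
HB.instance Definition _ := GRing.Zmodule.on (quotient_mod idP).

Let scale (a : A) (v : quotient_mod idP) : quotient_mod idP := pr (a * vsval v).

Let scale_pr a x : scale a (pr x) = pr (a * x).
Proof.
apply/esym/pr_eq; rewrite -mulrBr.
exact: left_idealP idP (prS x).
Qed.

Fact quotient_scaleA a b v : scale a (scale b v) = scale (a * b) v.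
Proof. by rewrite scale_pr mulrA. Qed.
Fact quotient_scale1 : left_id 1 scale.
Proof. by move=> v; rewrite /scale mul1r prK. Qed.
Fact quotient_scaleDr : right_distributive scale +%R.
Proof. by move=> a u v; rewrite /scale raddfD mulrDr /pr !raddfD. Qed.
Fact quotient_scaleDl v : {morph scale^~ v : a b / a + b}.
Proof. by move=> a b; rewrite /scale mulrDl /pr !raddfD. Qed.

HB.instance Definition _ := GRing.Zmodule_isLmodule.Build A (quotient_mod idP)
  quotient_scaleA quotient_scale1 quotient_scaleDr quotient_scaleDl.

Lemma quotient_module :
  exists (V : lmodType A) (q : {linear A^o -> V}),
    (forall v, exists x, q x = v) /\ (forall x : A, q x = 0 <-> x \in P).
Proof.
pose q (x : A^o) : quotient_mod idP := pr x.
have lin_q : linear q.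
  move=> a x y; rewrite /q; have -> : pr (a *: x + y) = pr (a * x) + pr y.
    by rewrite /pr !raddfD.
  by rewrite -scale_pr.
pose Q : {linear A^o -> quotient_mod idP} :=
  HB.pack q (GRing.isLinear.Build _ _ _ _ q lin_q).
exists (quotient_mod idP), Q; split=> [v|x]; first by exists (vsval v); apply: prK.
by split; [apply: pr_ker | apply: pr0].
Qed.
End QuotientModule.

(** * Residue fields of splitting algebras *)

Section Splitting.
Variables (F : fieldType) (A : falgType F).

Lemma tensor_ext (K : fieldType) (iota : {rmorphism F -> K}) (V W : zmodType)
    (sc : F -> V -> V) (t : K -> V -> W) (G : zmodType) (f1 f2 : {additive W -> G}) :
  is_tensor iota sc t -> (forall k v, f1 (t k v) = f2 (t k v)) -> f1 =1 f2.
Proof.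
move=> [[tDl tDr tZ] univ] f12.
have [|_ uniq] := univ G (fun k v => f1 (t k v)).
  by split=> *; rewrite ?tDl ?tDr ?raddfD ?tZ.
exact: uniq.
Qed.

(** The minimal polynomial of d modulo P; it is irreducible because A / P has no
    zero divisors. *)
Lemma minimal_poly_mod (P : {vspace A}) (d : A) :
  two_sided_ideal P -> 1 \notin P ->
  (forall x, x \notin P -> exists y, y * x - 1 \in P) ->
  exists2 p : {poly F}, monic_irreducible_poly p & horner_alg d p \in P.
Proof.
move=> idP P1 divP; pose ev := horner_alg d.
have domP x y : x * y \in P -> x \in P \/ y \in P.
  move=> xyP; have [|/divP[z zx]] := boolP (x \in P); [by left | right].
  have -> : y = z * (x * y) - (z * x - 1) * y by rewrite mulrBl mul1r !mulrA subKr.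
  apply: memvB; first exact: (two_sided_idealP z idP xyP).1.
  exact: (two_sided_idealP y idP zx).2.
have ex_p : exists n : nat,
    `[< exists2 p : {poly F}, p != 0 /\ ev p \in P & size p = n >].
  apply: contrapT => none; pose n := (\dim {:A}).+1.
  pose X := [tuple d ^+ i | i < n].
  have : free X.
    apply/freeP => k kX i; pose q := \sum_(j < n) k j *: 'X^j.
    have q0 : q = 0.
      apply/eqP; apply: contrapT => /negP q0; apply: none; exists (size q).
      apply/asboolP; exists q => //; split=> //.
      rewrite (_ : ev q = 0) ?mem0v // -[RHS]kX /ev linear_sum.
      apply: eq_bigr => j _; rewrite linearZ rmorphXn /= horner_algX.
      by rewrite (nth_map j) ?size_enum_ord // nth_ord_enum mulr_algl.
    have := congr1 (fun p : {poly F} => p`_i) q0; rewrite coef0 coef_sum.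
    rewrite (bigD1 i) //= big1 => [|j /negPf ji]; rewrite coefZ coefXn.
      by rewrite eqxx mulr1 addr0.
    by rewrite eq_sym (inj_eq val_inj) ji mulr0.
  rewrite /free size_tuple => /eqP dimX.
  by have := dimvS (subvf <<X>>); rewrite dimX ltnn.
case: (ex_minnP ex_p) => n /asboolP[p [p0 Pp] size_p] min_n.
have min_p (q : {poly F}) : q != 0 -> ev q \in P -> (size p <= size q)%N.
  by move=> q0 Pq; rewrite size_p; apply: min_n; apply/asboolP; exists q.
have lc0 : lead_coef p != 0 by rewrite lead_coef_eq0.
have lcV0 : (lead_coef p)^-1 != 0 by rewrite invr_eq0.
exists ((lead_coef p)^-1 *: p); last by rewrite linearZ /= mulr_algl memvZ.
split; last by rewrite monicE lead_coefZ mulVf.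
split.
  rewrite size_scale // ltnNge; apply/negP => /size1_polyC pC.
  move: Pp p0; rewrite pC /ev horner_algC rpredZeq polyC_eq0 => /orP[/eqP->|].
    by rewrite eqxx.
  by rewrite (negPf P1).
move=> q size_q; rewrite dvdpZr // => q_p.
apply: (@eqp_trans _ p); last by rewrite eqp_sym eqp_scale.
rewrite -dvdp_size_eqp // eqn_leq dvdp_leq //=.
have q0 : q != 0 by apply: contraTneq q_p => ->; rewrite dvd0p.
have /dvdpP[r pE] := q_p.
have r0 : r != 0 by apply: contraNneq p0 => r0; rewrite pE r0 mul0r.
have /domP[Pr|Pq] : ev r * ev q \in P by rewrite -rmorphM -pE.
  2: exact: min_p.
have := min_p r r0 Pr; rewrite {1}pE size_mul //.
have : (1 < size q)%N by rewrite ltn_neqAle eq_sym size_q size_poly_gt0.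
have : (0 < size r)%N by rewrite size_poly_gt0.
case: (size q) (size r) => [|[|j]] // [//|i] _ _.
by rewrite addnS addSn /= !addnS ltnNge leq_addr.
Qed.

(** With K = F[d] inside A / P acting on V = A / P from the right, the map
    h : K (x) V -> V, k (x) v |-> v k is additive and commutes with K (x) A up to
    that action, so its kernel is a submodule. It is proper as h (1 (x) 1) = 1, so
    it is zero by irreducibility; but it contains d (x) 1 - 1 (x) d, which is
    nonzero when d is not a scalar: a linear form t on V with t 1 = 0 and t d = 1
    sends it to -1. *)
Lemma splitting_residues_split : splitting A -> residues_split A.
Proof.
move=> splitA P idP P1 divP d; apply: contrapT => no_c.
have idPl : left_ideal P by case/andP: idP.
have [V [q [surj kerq]]] := quotient_module idPl.
have q_eq x y : q x = q y <-> x - y \in P.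
  have qB : q (x - y) = q x - q y by rewrite linearB.
  split=> [qxy|/kerq]; first by apply/kerq; rewrite qB qxy subrr.
  by rewrite qB => /eqP; rewrite subr_eq0 => /eqP.
have qZ (a x : A) : a *: q x = q (a * x : A) by rewrite -linearZ.
have qD (x y : A) : q x + q y = q (x + y : A) by rewrite -linearD.
have q10 : q 1 != 0 by apply: contraNneq P1 => /kerq.
have irrV : irreducible_module V.
  split=> [|U [U0 UD]]; first by exists (q 1).
  have [all0|] := pselect (forall v, v \in U -> v = 0); [by left | right].
  have UZ a v : v \in U -> a *: v \in U by move=> Uv; rewrite -[_ *: _]addr0 UD.
  have [v /not_implyP[Uv v0]] : exists v, ~ (v \in U -> v = 0) by apply/existsNP.
  have [x xv] := surj v.
  have [y yx] : exists y, y * x - 1 \in P.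
    by apply: divP; apply/negP => /kerq; rewrite xv.
  move=> w; have [z <-] := surj w.
  have -> : q z = z *: (y *: v); last by rewrite !UZ.
  have -> : z *: (y *: v) = q (z * (y * x)) by rewrite -xv -!linearZ.
  apply/q_eq; have -> : z - z * (y * x) = - (z * (y * x - 1)).
    by rewrite mulrBr mulr1 opprB.
  by rewrite memvN left_idealP.
have [p mi Pp] := minimal_poly_mod d idP P1 divP.
pose K : fieldType := {poly %/ p with mi}.
pose iota : {rmorphism F -> K} := GRing.in_alg {poly %/ p with mi}.
pose kap (k : K) : A := horner_alg d (k : {poly %/ p with mi}).
have modP (u : {poly F}) :
    horner_alg d (Pdiv.Ring.rmodp u (mk_monic p)) - horner_alg d u \in P.
  have mkE : mk_monic p = p by rewrite /mk_monic mi.1 mi.2.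
  rewrite mkE {2}(Pdiv.RingMonic.rdivp_eq mi.2 u) rmorphD rmorphM /=.
  by rewrite opprD addrC subrK memvN; apply: left_idealP idPl Pp.
have kapM k l : kap (k * l) - kap k * kap l \in P.
  by rewrite /kap -rmorphM; apply: modP.
have kapD k l : kap (k + l) = kap k + kap l by rewrite /kap -rmorphD.
have kapC k l : kap k * kap l = kap l * kap k by rewrite /kap -!rmorphM mulrC.
have kapZ k c : kap (k * iota c) = c *: kap k.
  by rewrite /iota /kap mulr_algr poly_of_qpolyZ linearZ /= mulr_algl.
have kap1 : kap 1 = 1.
  by rewrite /kap (qpolyCE p 1) rmorph1.
have [z kapz] : exists z, kap z - d \in P.
  exists (in_qpoly p 'X); rewrite -[in X in X \in P](horner_algX d).
  exact: modP.
have /choice[s sK] := surj.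
have sq x : s (q x) - x \in P by apply/q_eq; rewrite sK.
(* rho k is right multiplication by k on V. *)
pose rho (k : K) (v : V) : V := q (s v * kap k).
have rhoq k x : rho k (q x) = q (x * kap k).
  by apply/q_eq; rewrite -mulrBl; case: (two_sided_idealP (kap k) idP (sq x)).
clearbody rho.
have [t [td t0]] : exists t : {scalar A}, t d = 1 /\
    forall u, u \in (P + <[1]>)%VS -> t u = 0.
  apply: separating_functional; apply/negP => /memv_addP[x Px [_ /vlineP[c ->] dE]].
  by apply: no_c; exists c; rewrite dE addrK.
have tP x : x \in P -> t x = 0 by move=> Px; rewrite t0 // (subvP (addvSl _ _)).
have t1 : t 1 = 0 by rewrite t0 // memvE addvSr.
have tq x y : x - y \in P -> t x = t y.
  by move=> /tP; rewrite linearB => /eqP; rewrite subr_eq0 => /eqP.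
have [_ /(_ K iota)] := splitA V irrV.
move=> [B [tA [W [tV [tensA mulAA tensV mulAV [_ irrW]]]]]].
have [rhoDl rhoDr] : (forall k l v, rho (k + l) v = rho k v + rho l v) /\
    (forall k u v, rho k (u + v) = rho k u + rho k v).
  split=> k u v.
    by have [x <-] := surj v; rewrite !rhoq kapD mulrDr qD.
  have [x <-] := surj u; have [y <-] := surj v.
  by rewrite qD !rhoq qD mulrDl.
have rhoM a k v : a *: rho k v = rho k (a *: v).
  by have [x <-] := surj v; rewrite qZ !rhoq qZ mulrA.
have rhoMr k l v : rho k (rho l v) = rho (k * l) v.
  have [x <-] := surj v; rewrite !rhoq; apply/q_eq; rewrite -mulrA kapC -mulrBr.
  by rewrite -opprB mulrN memvN left_idealP.
have [_ /(_ V rho)[|[h hE] _]] := tensV.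
  split=> // k c v; have [x <-] := surj v.
  rewrite qZ !rhoq kapZ -scalerAr -mulrA; congr (q _).
  exact: esym (mulr_algl c (x * kap k : A)).
have h_tA k a w : h (tA k a *: w) = rho k (a *: h w).
  pose f1 : {additive W -> V} := h \o GRing.scale (tA k a).
  pose f2 w := rho k (a *: h w).
  have f2D : zmod_morphism f2.
    move=> u v; rewrite /f2 raddfB scalerBr; apply/eqP.
    by rewrite eq_sym subr_eq -rhoDr subrK.
  pose F2 : {additive W -> V} := HB.pack f2 (GRing.isZmodMorphism.Build _ _ f2 f2D).
  have -> : h (tA k a *: w) = f1 w by [].
  have -> : rho k (a *: h w) = F2 w by [].
  apply: (tensor_ext tensV) => l v; rewrite /= /f2 mulAV !hE.
  by rewrite rhoM rhoMr.
have kerB b w : h w = 0 -> h (b *: w) = 0.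
  move=> hw; pose f1 := fun b : B => h (b *: w).
  have f1D : zmod_morphism f1 by move=> u v; rewrite /f1 scalerBl raddfB.
  pose F1 : {additive B -> V} := HB.pack f1 (GRing.isZmodMorphism.Build _ _ f1 f1D).
  have -> : h (b *: w) = F1 b by [].
  have -> : 0 = (\0 : {additive B -> V}) b by [].
  apply: (tensor_ext tensA) => k a; rewrite /= /f1 h_tA hw scaler0.
  have := rhoDr k 0 0; rewrite addr0 => /eqP.
  by rewrite addrC -subr_eq subrr => /eqP.
have hB u v : h (u - v) = h u - h v by rewrite raddfB.
have [|all0|allW] := irrW [pred w | h w == 0].
- split=> [|b u v]; rewrite !inE ?raddf0 // => /eqP hu /eqP hv.
  by rewrite raddfD kerB // hv addr0.
- have w0 : tV z (q 1) - tV 1 (q d) = 0.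
    apply: all0; rewrite inE hB !hE !rhoq kap1 mulr1 mul1r subr_eq0.
    exact/eqP/q_eq.
  have [_ /(_ K (fun k v => k * iota (t (s v))))[|[e eE] _]] := tensV.
    have ts x : t (s (q x)) = t x by apply: tq.
    split=> [k l v|k u v|k c v]; first exact: mulrDl.
      have [x <-] := surj u; have [y <-] := surj v.
      by rewrite qD !ts linearD rmorphD mulrDr.
    have [x <-] := surj v; rewrite qZ !ts mulr_algl linearZ /=.
    by rewrite -mulrA mulr_algl scalerA.
  have : e (tV z (q 1) - tV 1 (q d)) = -1.
    rewrite raddfB !eE !(tq _ _ (sq _)) t1 td rmorph0 rmorph1.
    by rewrite mulr0 mulr1 sub0r.
  by rewrite w0 raddf0 => /eqP; rewrite eq_sym oppr_eq0 oner_eq0.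
have := allW (tV 1 (q 1)); rewrite inE hE rhoq kap1 mulr1.
by rewrite (negPf q10).
Qed.
End Splitting.

Theorem corollary3p12 (F : fieldType) (A : falgType F) :
  (splitting A -> finite_global_dimension A -> zero_product_determined A) /\
  (quasi_hereditary A -> cellular A -> zero_product_determined A).
Proof.
split=> [splitA gldim|qhA cellA];
  apply: zero_product_determined_of_idempotents => E EM idemE;
  apply: idempotents_generate EM idemE _ _.
- exact: splitting_residues_split.
- exact: gldim_no_self_extensions.
- exact: cellular_residues_split.
- exact: quasi_hereditary_no_self_extensions.
Qed.
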